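(* Let $H$ be an infinite dimensional complex Hilbert space and let $T \in \mathcal{AN}(H)$ be $\ast$-paranormal. Then $H = H_0 \oplus H_1 \oplus H_2$ and, with respect to this decomposition, $$T = \begin{pmatrix} V_0 & 0 & 0 \\ 0 & \lambda V & A \\ 0 & 0 & B \end{pmatrix},$$ where (1) $\sigma_{ess}(|T|) = \{\lambda\}$ with $\lambda \geq 0$; (2) $H_0 = \bigoplus_{i=1}^{n} N(|T| - \alpha_i I)$, where $(\lambda, \|T\|] \cap \sigma(|T|) = \{\alpha_i\}_{i=1}^{n}$ (the $\alpha_i$ distinct) for some $n \in \mathbb{N} \cup \{\infty\}$ (or this set is empty, in which case $H_0 = \{0\}$), $H_1 = N(|T| - \lambda I)$, and $H_2 = (H_0 \oplus H_1)^\perp$ is finite dimensional; (3) $V_0 = \bigoplus_{i=1}^{n} \alpha_i U_i$, where $U_i \in \mathcal{B}(N(|T| - \alpha_i I))$ is unitary for each $i$; (4) $V \in \mathcal{B}(H_1)$ is an isometry if $H_1 \neq \{0\}$, and $A \in \mathcal{B}(H_2, H_1)$, $B \in \mathcal{B}(H_2)$ are finite rank operators such that $V^*A = 0$, $A^*A + B^*B \leq \lambda^2 I_{H_2}$ and $(\lambda^4 + k^2) I_{H_2} - 2k BB^* \geq 0$ for all $k > 0$.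
   Context: $\mathcal{B}(H_1,H_2)$ denotes the bounded linear operators from $H_1$ to $H_2$, $\mathcal{B}(H)=\mathcal{B}(H,H)$, $N(\cdot)$ denotes the null space, and $|T| = (T^*T)^{1/2}$. An operator $T \in \mathcal{B}(H)$ is absolutely norm attaining, written $T \in \mathcal{AN}(H)$, if for every nonzero closed subspace $L$ of $H$ there is a unit vector $x \in L$ with $\|Tx\| = \|T|_L\|$. $T$ is $\ast$-paranormal if $\|T^*x\|^2 \leq \|T^2x\|\,\|x\|$ for all $x \in H$. The essential spectrum $\sigma_{ess}(S)$ of $S\in\mathcal{B}(H)$ is the spectrum of the image of $S$ in the Calkin algebra $\mathcal{B}(H)/\mathcal{K}(H)$, where $\mathcal{K}(H)$ is the ideal of compact operators. The spaces $H_0,H_1,H_2$ are closed subspaces of $H$, possibly finite dimensional or $\{0\}$; when one is $\{0\}$ the corresponding blocks are absent. *)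

(* Defs.v *)
From HB Require Import structures.
From mathcomp Require Import all_boot all_order all_algebra sesquilinear.
From mathcomp Require Import complex.
From mathcomp Require Import all_classical all_reals all_analysis.

Set Implicit Arguments.
Unset Strict Implicit.
Unset Printing Implicit Defensive.

Import Order.TTheory GRing.Theory Num.Theory.
Import numFieldNormedType.Exports.

Local Open Scope classical_set_scope.
Local Open Scope ring_scope.
Local Open Scope complex_scope.

(* A complex Hilbert space is a completeNormedModType over R[i] together with a
   dot product inducing its norm; the dot product is linear in its first
   argument and conjugate-linear in the second. Norms take their values in the
   nonnegative reals of R[i], and x <= y in R[i] means that y - x is a
   nonnegative real. *)
Definition hilbert_dot (R : realType) (H : completeNormedModType R[i])
    (dot : {dot H for Num.conj}) : Prop :=
  forall x : H, `|x| ^+ 2 = dot x x.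

Section Subspaces.
Context {R : realType} {H : completeNormedModType R[i]}.
Implicit Types (M N : set H).

Definition closed_subspace M : Prop :=
  [/\ M 0, forall (a : R[i]) x y, M x -> M y -> M (a *: x + y) & closed M].

Definition finite_dim M : Prop :=
  exists (n : nat) (e : 'I_n -> H),
    forall x, M x -> exists c : 'I_n -> R[i], x = \sum_(i < n) c i *: e i.

Definition closed_span (X : set H) : set H :=
  [set x | forall M, closed_subspace M -> X `<=` M -> M x].

End Subspaces.

Section Orthogonality.
Context {R : realType} {H : completeNormedModType R[i]}.
Variable dot : {dot H for Num.conj}.
Implicit Types (M N : set H).

Definition orthogonal_sets M N : Prop :=
  forall x y, M x -> N y -> dot x y = 0.

Definition orth_compl M : set H := [set x | forall y, M y -> dot x y = 0].

(* H = M0 (+) M1 (+) M2 *)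
Definition orth_decomposition M0 M1 M2 : Prop :=
  [/\ [/\ closed_subspace M0, closed_subspace M1 & closed_subspace M2],
      [/\ orthogonal_sets M0 M1, orthogonal_sets M0 M2 & orthogonal_sets M1 M2]
    & forall x, exists x0 x1 x2, [/\ M0 x0, M1 x1, M2 x2 & x = x0 + x1 + x2]].

(* M is the Hilbert space direct sum of the closed subspaces F i, i in J. *)
Definition hilbert_sum (J : set nat) (F : nat -> set H) M : Prop :=
  [/\ forall i, J i -> closed_subspace (F i),
      forall i j, J i -> J j -> i <> j -> orthogonal_sets (F i) (F j)
    & M = closed_span (\bigcup_(i in J) F i)].

End Orthogonality.

(* For closed subspaces M and N of H, an element of B(M, N) is represented by a
   function H -> H of which only the restriction to M is meaningful; B(H) is
   the case M = N = setT. *)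
Section Operators.
Context {R : realType} {H : completeNormedModType R[i]}.
Implicit Types (M N L : set H) (S : H -> H).

Definition bounded_op M N S : Prop :=
  [/\ forall x, M x -> N (S x),
      forall (a : R[i]) x y, M x -> M y -> S (a *: x + y) = a *: S x + S y
    & exists C : R, forall x, M x -> `|S x| <= C%:C * `|x|].

(* Re only turns the norm, a nonnegative real of R[i], into an element of R. *)
Definition op_norm L S : R :=
  sup [set complex.Re `|S x| | x in [set x | L x /\ `|x| <= 1]].

Definition absolutely_norm_attaining S : Prop :=
  bounded_op setT setT S /\
  forall L, closed_subspace L -> L <> [set 0] ->
    exists x, [/\ L x, `|x| = 1 & `|S x| = (op_norm L S)%:C].

Definition finite_rank M S : Prop := finite_dim (S @` M).

Definition compact_op S : Prop :=
  bounded_op setT setT S /\ precompact (S @` [set x | `|x| <= 1]).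

Definition isometry_on M S : Prop := forall x, M x -> `|S x| = `|x|.

Definition shift S (z : R[i]) : H -> H := fun x => S x - z *: x.

Definition null_space S : set H := S @^-1` [set 0].

Definition spectrum S : set R[i] :=
  [set z | ~ exists2 G, bounded_op setT setT G &
      (forall x, G (shift S z x) = x) /\ (forall x, shift S z (G x) = x)].

(* S and S' have the same image in the Calkin algebra B(H) / K(H) *)
Definition calkin_eq S S' : Prop := compact_op (fun x => S x - S' x).

Definition calkin_unit S : Prop :=
  exists2 G, bounded_op setT setT G &
    calkin_eq (G \o S) id /\ calkin_eq (S \o G) id.

Definition ess_spectrum S : set R[i] := [set z | ~ calkin_unit (shift S z)].

End Operators.

Section Adjoints.
Context {R : realType} {H : completeNormedModType R[i]}.
Variable dot : {dot H for Num.conj}.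
Implicit Types (M N : set H) (S : H -> H).

(* The adjoint in B(N, M) of S in B(M, N); it is unique as a map on N. *)
Definition adjoint M N S : H -> H :=
  xget (fun=> 0) [set S' | bounded_op N M S' /\
    forall x y, M x -> N y -> dot (S x) y = dot x (S' y)].

Definition op_le M S S' : Prop :=
  forall x, M x -> dot (S x) x <= dot (S' x) x.

(* The unique positive square root of a positive S in B(H). *)
Definition sqrt_op S : H -> H :=
  xget (fun=> 0) [set P | [/\ bounded_op setT setT P,
    op_le setT (fun=> 0) P & forall x, P (P x) = S x]].

Definition abs_op S : H -> H := sqrt_op (adjoint setT setT S \o S).

Definition star_paranormal S : Prop :=
  forall x, `|adjoint setT setT S x| ^+ 2 <= `|S (S x)| * `|x|.

Definition unitary_on M S : Prop :=
  [/\ bounded_op M M S, forall x, M x -> adjoint M M S (S x) = x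
    & forall x, M x -> S (adjoint M M S x) = x].

(* N(|S| - a I) *)
Definition abs_eigenspace S (a : R) : set H :=
  null_space (shift (abs_op S) a%:C).

End Adjoints.

(* Main.v *)
(* |T| exists because T^*T, rescaled to lie between 0 and 1, is (1 - Y)^2 for
   the fixed point Y of Y = ((1 - T^*T) + Y^2) / 2, obtained by iteration
   from 0; the scalar iteration controls the convergence in norm.

   For T absolutely norm attaining, a maximizer of ||Tx|| over the unit
   sphere of an invariant subspace is an eigenvector of |T|, so the
   eigenvectors of |T| span H. On the closed span of an orthonormal sequence
   g_n whose images under |T| are orthogonal with strictly increasing norms,
   |T| does not attain its norm. Applied to eigenvectors, and to rotations of
   one eigenvector towards another, this shows that all but finitely many
   eigenvalues, with multiplicity, lie in [lambda, lambda + e) for each e >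
   0, where lambda is the supremum of the a such that the eigenvalues at
   least a have infinite total multiplicity. Hence |T| - lambda is compact,
   which gives the essential spectrum and the spectrum above lambda.

   Let W be the span of the eigenspaces N(|T| - a), a > lambda, that reduce
   T. If ||Tx|| had a maximum m > lambda on the unit sphere of the orthogonal
   complement of W, then for x in N(|T| - m) star-paranormality at Tx would
   give ||T(Tx)|| = m ||Tx||, so N(|T| - m) would be invariant under T; being
   finite dimensional, it would reduce T, contradicting its orthogonality to
   W. So ||Tx|| <= lambda ||x|| on the complement of W, all eigenspaces above
   lambda reduce T, and the assertions on V, A and B follow from this bound. *)
Require Import Defs.
From HB Require Import structures.
From mathcomp Require Import all_boot all_order all_algebra sesquilinear.
From mathcomp Require Import complex.
From mathcomp Require Import all_classical all_reals all_analysis.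
From mathcomp Require Import ring lra.

Set Implicit Arguments.
Unset Strict Implicit.
Unset Printing Implicit Defensive.

Import Order.TTheory GRing.Theory Num.Theory.
Import numFieldNormedType.Exports.

Local Open Scope classical_set_scope.
Local Open Scope ring_scope.
Local Open Scope complex_scope.

Lemma ReJ (R : realType) (a : R[i]) : complex.Re a^*%C = complex.Re a.
Proof. by case: a. Qed.

Lemma conjcM (R : realType) (a b : R[i]) : (a * b)^*%C = a^*%C * b^*%C.
Proof. exact: rmorphM. Qed.

(** * Real-valued norm and inner product *)

Section RealNorm.
Context {R : realType} {H : completeNormedModType R[i]}.
Implicit Types (x y : H) (a : R[i]) (r : R).

(** Takes values in the ordered field [R], where total order, [lra] and [nra] are available; the
    library norm lies in [R[i]]. *)
Definition nrm x : R := complex.Re `|x|.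

Lemma normE x : `|x| = (nrm x)%:C.
Proof. by rewrite RRe_real// ger0_real. Qed.

Lemma nrm_ge0 x : 0 <= nrm x.
Proof. by rewrite -ler0c -normE. Qed.

Lemma nrm0 : nrm 0 = 0.
Proof. by rewrite /nrm normr0. Qed.

Lemma nrm_eq0 x : nrm x = 0 -> x = 0.
Proof. by move=> h; apply/normr0_eq0; rewrite normE h. Qed.

Lemma nrm_gt0 x : x <> 0 -> 0 < nrm x.
Proof.
by move=> x0; rewrite lt_neqAle nrm_ge0 andbT; apply/eqP => /esym/nrm_eq0.
Qed.

Lemma nrmN x : nrm (- x) = nrm x.
Proof. by rewrite /nrm normrN. Qed.

Lemma nrmZ a x : nrm (a *: x) = complex.Re `|a| * nrm x.
Proof.
apply: complexI; rewrite -normE normrZ rmorphM/= -normE.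
by congr (_ * _); rewrite RRe_real// ger0_real.
Qed.

Lemma normcR r : `|r%:C| = `|r|%:C.
Proof. by rewrite normc_def/= expr0n addr0 sqrtr_sqr. Qed.

Lemma nrmZr r x : nrm (r%:C *: x) = `|r| * nrm x.
Proof. by rewrite nrmZ normcR. Qed.

Lemma nrmD x y : nrm (x + y) <= nrm x + nrm y.
Proof. by rewrite -lecR rmorphD/= -!normE ler_normD. Qed.

Lemma nrmB x y : nrm (x - y) <= nrm x + nrm y.
Proof. by rewrite -(nrmN y) nrmD. Qed.

Lemma nrmC x y : nrm (x - y) = nrm (y - x).
Proof. by rewrite -nrmN opprB. Qed.

Lemma nrm_tri z x y : nrm (x - y) <= nrm (x - z) + nrm (z - y).
Proof. by rewrite -[x - y](subrKA z) nrmD. Qed.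

Lemma leB_nrm x y : nrm x - nrm y <= nrm (x - y).
Proof. by rewrite lerBlDr -{1}(subrK y x) nrmD. Qed.

End RealNorm.

Section DotProduct.
Context {R : realType} {H : completeNormedModType R[i]}.
Variable dot : {dot H for Num.conj}.
Implicit Types (x y z : H) (a : R[i]) (r : R).

Lemma dot0l y : dot 0 y = 0. Proof. exact: linear0l. Qed.
Lemma dot0r y : dot y 0 = 0. Proof. exact: linear0r. Qed.
Lemma dotDl x y z : dot (x + y) z = dot x z + dot y z.
Proof. exact: linearDl. Qed.
Lemma dotDr x y z : dot z (x + y) = dot z x + dot z y.
Proof. exact: linearDr. Qed.
Lemma dotNr x z : dot z (- x) = - dot z x.
Proof. exact: linearNr. Qed.
Lemma dotBl x y z : dot (x - y) z = dot x z - dot y z.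
Proof. exact: linearBl. Qed.
Lemma dotBr x y z : dot z (x - y) = dot z x - dot z y.
Proof. exact: linearBr. Qed.
Lemma dotZl a x z : dot (a *: x) z = a * dot x z.
Proof. exact: linearZl_LR. Qed.
Lemma dotZr a x z : dot z (a *: x) = a^*%C * dot z x.
Proof. by rewrite linearZr_LR. Qed.
Lemma dotC x y : dot x y = (dot y x)^*%C.
Proof. by rewrite hermC expr0 mul1r. Qed.
Lemma dotZrr r x z : dot z (r%:C *: x) = r%:C * dot z x.
Proof. by rewrite dotZr conjc_real. Qed.

Lemma dot_eq0C x y : dot x y = 0 -> dot y x = 0.
Proof. by move=> h; rewrite dotC h conjc0. Qed.

Lemma dot_suml (I : Type) (s : seq I) (F : I -> H) z :
  dot (\sum_(i <- s) F i) z = \sum_(i <- s) dot (F i) z.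
Proof. exact: linear_sumlz. Qed.

Hypothesis hdot : hilbert_dot dot.

Lemma dotxx x : dot x x = (nrm x ^+ 2)%:C.
Proof. by rewrite -hdot normE rmorphXn. Qed.

Lemma sqr_nrm x : nrm x ^+ 2 = complex.Re (dot x x).
Proof. by rewrite dotxx. Qed.

Lemma dotxx_eq0 x : dot x x = 0 -> x = 0.
Proof.
rewrite dotxx => /(congr1 (@complex.Re R))/= /eqP.
by rewrite sqrf_eq0 => /eqP/nrm_eq0.
Qed.

Lemma dot_ext x y : (forall z, dot x z = dot y z) -> x = y.
Proof.
by move=> h; apply/subr0_eq/dotxx_eq0; rewrite dotBl h subrr.
Qed.

Lemma sqr_nrmD x y : nrm (x + y) ^+ 2 =
  nrm x ^+ 2 + nrm y ^+ 2 + 2 * complex.Re (dot x y).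
Proof.
rewrite !sqr_nrm !(dotDl, dotDr) (dotC y x) !raddfD/= ReJ; lra.
Qed.

Lemma sqr_nrmB x y : nrm (x - y) ^+ 2 =
  nrm x ^+ 2 + nrm y ^+ 2 - 2 * complex.Re (dot x y).
Proof. by rewrite sqr_nrmD nrmN dotNr raddfN/= mulrN. Qed.

Lemma pythagoras x y : dot x y = 0 ->
  nrm (x + y) ^+ 2 = nrm x ^+ 2 + nrm y ^+ 2.
Proof. by move=> xy; rewrite sqr_nrmD xy mulr0 addr0. Qed.

Lemma parallelogram x y :
  nrm (x + y) ^+ 2 + nrm (x - y) ^+ 2 = 2 * (nrm x ^+ 2 + nrm y ^+ 2).
Proof. by rewrite sqr_nrmD sqr_nrmB; lra. Qed.

(** Cauchy-Schwarz for the real part, read off from the nonnegative square of the norm of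
    [|y| x - |x| y]. *)
Lemma Re_dot_le x y : complex.Re (dot x y) <= nrm x * nrm y.
Proof.
have [->|/eqP/nrm_gt0 x0] := eqVneq x 0; first by rewrite dot0l nrm0 mul0r.
have [->|/eqP/nrm_gt0 y0] := eqVneq y 0; first by rewrite dot0r nrm0 mulr0.
have := sqr_ge0 (nrm ((nrm y)%:C *: x - (nrm x)%:C *: y)).
rewrite sqr_nrmB !nrmZr !ger0_norm ?nrm_ge0// dotZl dotZrr mulrA -rmorphM/=.
have -> : complex.Re ((nrm y * nrm x)%:C * dot x y) =
    nrm y * nrm x * complex.Re (dot x y).
  by case: (dot x y) => p q; simpc.
move: x0 y0; set u := nrm x; set v := nrm y => u0 v0 h.
have uv0 : 0 < u * v by rewrite mulr_gt0.
rewrite -(ler_pM2l uv0); nra.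
Qed.

(** Multiplying [x] by a scalar of modulus one makes the product real and nonnegative, which reduces
    the claim to [Re_dot_le]. *)
Lemma norm_dot_le x y : complex.Re `|dot x y| <= nrm x * nrm y.
Proof.
set d := dot x y; have [->|d0] := eqVneq d 0.
  by rewrite normr0 mulr_ge0 ?nrm_ge0.
have := Re_dot_le ((d^*%C / `|d|) *: x) y.
rewrite dotZl -/d mulrAC -[d^*%C * d]mulrC -sqr_normc expr2 mulfK ?normr_eq0//.
by rewrite nrmZ normrM normrV ?unitfE ?normr_eq0// normr_id normcJ divff
  ?normr_eq0// mul1r.
Qed.

End DotProduct.

(** * Sequences, bounded operators and closed subspaces *)

Section Sequences.
Context {R : realType} {H : completeNormedModType R[i]}.
Implicit Types (x y l : H) (M X : set H) (u : nat -> H).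

Lemma inv_natS_lt (e : R) : 0 < e -> exists N, forall n, (N <= n)%N ->
  n.+1%:R^-1 < e.
Proof.
move=> e0; exists (Num.truncn e^-1) => n nN.
rewrite invf_plt ?posrE//; apply: lt_le_trans (_ : (Num.truncn e^-1).+1%:R <=
  _).
  by apply: truncnS_gt.
by rewrite ler_nat.
Qed.

Lemma ball_nrm x (e : R) y : ball x e%:C y = (nrm (x - y) < e).
Proof. by rewrite -ball_normE /ball_/= normE ltcR. Qed.

Lemma gt0_complex (e : R[i]) : 0 < e -> exists2 r : R, 0 < r & e = r%:C.
Proof.
by case: e => a b; rewrite ltcE/= => /andP[/eqP-> a0]; exists a.
Qed.

Definition seq_lim u l := forall e : R, 0 < e ->
  exists N, forall n, (N <= n)%N -> nrm (u n - l) < e.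

Definition seq_cauchy u := forall e : R, 0 < e ->
  exists N, forall m n, (N <= m)%N -> (N <= n)%N -> nrm (u m - u n) < e.

Lemma seq_cauchy_lim u : seq_cauchy u -> exists l, seq_lim u l.
Proof.
move=> uC.
have /cvg_ex[l ul] : cvgn u.
  apply: cauchy_cvg; apply: cauchy_exP => e /gt0_complex[r r0 ->].
  have [N uN] := uC _ r0; exists (u N); exists N => // n /= Nn.
  by rewrite ball_nrm; apply: uN.
exists l => e e0; have e0C : 0 < e%:C by rewrite ltcR.
have /cvg_ballP/(_ _ e0C)[N _ uN] := ul.
by exists N => n Nn; rewrite nrmC -ball_nrm; apply: uN.
Qed.

Lemma closed_approx M : closed M <->
  forall x, (forall e : R, 0 < e -> exists2 y, M y & nrm (x - y) < e) -> M x.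
Proof.
split=> [cM x xM|h x xM].
  apply: cM => B /nbhs_ballP[_ /= /gt0_complex[r r0 ->] rB].
  have [y My xy] := xM _ r0; exists y; split => //.
  by apply: rB; rewrite ball_nrm.
apply: h => e e0; have e0C : 0 < e%:C by rewrite ltcR.
have [y [My]] := xM _ (nbhsx_ballx x _ e0C).
by rewrite ball_nrm => xy; exists y.
Qed.

Lemma closed_seq_lim M u l : closed M -> (forall n, M (u n)) -> seq_lim u l ->
  M l.
Proof.
move=> /closed_approx cM Mu ul; apply: cM => e /ul[N uN].
by exists (u N) => //; rewrite nrmC uN.
Qed.

(** The bound is asked only up to [e] and eventually, which is what a minimizing sequence
    provides. *)
Lemma nrm_seq_lim u l (a : R) : seq_lim u l ->
  (forall e, 0 < e -> exists N, forall n, (N <= n)%N -> nrm (u n) <= a + e) ->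
  nrm l <= a.
Proof.
move=> ul ua; apply/ler_addgt0Pr => e e0.
have e20 : 0 < e / 2 by rewrite divr_gt0.
have [N1 h1] := ul _ e20; have [N2 h2] := ua _ e20.
have /h1 {}h1 := leq_maxl N1 N2; have /h2 {}h2 := leq_maxr N1 N2.
have := leB_nrm l (u (maxn N1 N2)); rewrite nrmC; lra.
Qed.

Lemma seq_lim_unique u l (l' : H) : seq_lim u l -> seq_lim u l' -> l = l'.
Proof.
move=> ul ul'; apply/subr0_eq/nrm_eq0/le_anti/andP; split; last exact: nrm_ge0.
apply/ler_addgt0Pr => e e0; have e20 : 0 < e / 2 by rewrite divr_gt0.
have [N1 h1] := ul _ e20; have [N2 h2] := ul' _ e20.
have /h1 {}h1 := leq_maxl N1 N2; have /h2 {}h2 := leq_maxr N1 N2.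
have := nrm_tri (u (maxn N1 N2)) l l'; rewrite nrmC in h1; lra.
Qed.

Lemma seq_limD u (v : nat -> H) l (l' : H) : seq_lim u l -> seq_lim v l' ->
  seq_lim (fun n => u n + v n) (l + l').
Proof.
move=> ul ul' e e0; have e20 : 0 < e / 2 by rewrite divr_gt0.
have [N1 h1] := ul _ e20; have [N2 h2] := ul' _ e20.
exists (maxn N1 N2) => n; rewrite geq_max => /andP[/h1 {}h1 /h2 {}h2].
rewrite opprD addrACA; apply: le_lt_trans (nrmD _ _) _; lra.
Qed.

Lemma seq_limS u l : seq_lim u l -> seq_lim (fun n => u n.+1) l.
Proof.
by move=> ul e /ul[N h]; exists N => n Nn; apply: h; apply: leq_trans Nn _.
Qed.

End Sequences.

Section BoundedOperators.
Context {R : realType} {H : completeNormedModType R[i]}.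
Implicit Types (x y : H) (M X : set H) (S : H -> H).

Definition bop S := bounded_op setT setT S.

Lemma bop_lin S (a : R[i]) x y : bop S -> S (a *: x + y) = a *: S x + S y.
Proof. by case=> _ h _; apply: h. Qed.

Lemma bopD S x y : bop S -> S (x + y) = S x + S y.
Proof. by move=> bS; rewrite -[x]scale1r bop_lin// !scale1r. Qed.

Lemma bop0 S : bop S -> S 0 = 0.
Proof. by move=> bS; apply: (addIr (S 0)); rewrite -bopD// !add0r. Qed.

Lemma bopZ S (a : R[i]) x : bop S -> S (a *: x) = a *: S x.
Proof. by move=> bS; rewrite -[a *: x]addr0 bop_lin// bop0// addr0. Qed.

Lemma bopN S x : bop S -> S (- x) = - S x.
Proof. by move=> bS; rewrite -scaleN1r bopZ// scaleN1r. Qed.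

Lemma bopB S x y : bop S -> S (x - y) = S x - S y.
Proof. by move=> bS; rewrite bopD// bopN. Qed.

Lemma bop_sum S (I : Type) (s : seq I) (F : I -> H) : bop S ->
  S (\sum_(i <- s) F i) = \sum_(i <- s) S (F i).
Proof.
move=> bS; elim: s => [|i s IH]; first by rewrite !big_nil bop0.
by rewrite !big_cons bopD// IH.
Qed.

Lemma op_bound M (N : set H) S : bounded_op M N S ->
  exists2 C : R, 0 < C & forall x, M x -> nrm (S x) <= C * nrm x.
Proof.
case=> _ _ [C h]; exists (`|C| + 1) => [|x Mx].
  by rewrite ltr_wpDl.
apply: le_trans (_ : C * nrm x <= _).
  by have := h x Mx; rewrite !normE -rmorphM/= lecR.
by rewrite ler_wpM2r ?nrm_ge0// (le_trans (ler_norm C))// lerDl.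
Qed.

Lemma bop_bound S : bop S ->
  exists2 C : R, 0 < C & forall x, nrm (S x) <= C * nrm x.
Proof. by move=> /op_bound[C C0 h]; exists C => // x; apply: h. Qed.

Lemma bounded_opI M (N : set H) S (C : R) : (forall x, M x -> N (S x)) ->
  (forall (a : R[i]) x y, M x -> M y -> S (a *: x + y) = a *: S x + S y) ->
  (forall x, M x -> nrm (S x) <= C * nrm x) -> bounded_op M N S.
Proof.
by move=> h1 h2 h3; split => //; exists C => x /h3;
  rewrite !normE -rmorphM/= lecR.
Qed.

Lemma bopI S (C : R) :
  (forall (a : R[i]) x y, S (a *: x + y) = a *: S x + S y) ->
  (forall x, nrm (S x) <= C * nrm x) -> bop S.
Proof. by move=> h1 h2; apply: (@bounded_opI _ _ _ C). Qed.

Lemma bounded_op_sub M (N M' N' : set H) S : M `<=` M' -> (forall x, M x -> N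
  (S x)) ->
  bounded_op M' N' S -> bounded_op M N S.
Proof.
move=> MM SN [h1 h2 [C h3]]; split => //.
  by move=> a x y /MM ? /MM ?; apply: h2.
by exists C => x /MM; apply: h3.
Qed.

Lemma bop_id : bop id.
Proof. by apply: (@bopI _ 1) => // x; rewrite mul1r. Qed.

Lemma bop_comp S (S' : H -> H) : bop S -> bop S' -> bop (fun x => S (S' x)).
Proof.
move=> bS bS'; have [C C0 h] := bop_bound bS; have [D D0 k] := bop_bound bS'.
apply: (@bopI _ (C * D)) => [a x y|x].
  by rewrite (bop_lin _ _ _ bS') (bop_lin _ _ _ bS).
by rewrite (le_trans (h _))// -mulrA ler_pM2l.
Qed.

Lemma bop_add S (S' : H -> H) : bop S -> bop S' -> bop (fun x => S x + S' x).
Proof.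
move=> bS bS'; have [C C0 h] := bop_bound bS; have [D D0 k] := bop_bound bS'.
apply: (@bopI _ (C + D)) => [a x y|x].
  by rewrite (bop_lin _ _ _ bS) (bop_lin _ _ _ bS') scalerDr addrACA.
by rewrite (le_trans (nrmD _ _))// mulrDl lerD.
Qed.

Lemma bop_scale (a : R[i]) S : bop S -> bop (fun x => a *: S x).
Proof.
move=> bS; have [C C0 h] := bop_bound bS.
apply: (@bopI _ (complex.Re `|a| * C)) => [b x y|x].
  by rewrite (bop_lin _ _ _ bS) scalerDr !scalerA mulrC.
rewrite nrmZ -mulrA ler_wpM2l//.
by rewrite -ler0c RRe_real// ger0_real.
Qed.

Lemma bop_sub S (S' : H -> H) : bop S -> bop S' -> bop (fun x => S x - S' x).
Proof.
move=> bS bS'; rewrite (_ : (fun x => _) = (fun x => S x + (-1) *: S' x)).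
  by apply: bop_add => //; apply: bop_scale.
by apply/funext => x; rewrite scaleN1r.
Qed.

Lemma bop_shift S (z : R[i]) : bop S -> bop (Defs.shift S z).
Proof. by move=> bS; apply: bop_sub => //; apply: bop_scale bop_id. Qed.

Lemma bop_iter S n : bop S -> bop (iter n S).
Proof.
by move=> bS; elim: n => [|n IH]; [apply: bop_id|apply: bop_comp].
Qed.

Lemma bop_seq_lim S u l : bop S -> seq_lim u l -> seq_lim (S \o u) (S l).
Proof.
move=> bS ul e e0; have [C C0 h] := bop_bound bS.
have [N uN] := ul _ (divr_gt0 e0 C0); exists N => n /uN.
by rewrite ltr_pdivlMr// mulrC /= -bopB//; apply: le_lt_trans.
Qed.

Lemma bop_continuous S : bop S -> continuous S.
Proof.
move=> bS x; have [C C0 h] := bop_bound bS.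
apply/cvgrPdist_lt => _ /gt0_complex[r r0 ->].
have r0' : 0 < (r / C)%:C by rewrite ltcR divr_gt0.
near=> y; rewrite -bopB// normE ltcR (le_lt_trans (h _))//.
have : ball x (r / C)%:C y by near: y; apply: nbhsx_ballx.
by rewrite ball_nrm ltr_pdivlMr// mulrC.
Unshelve. all: by end_near. Qed.

End BoundedOperators.

Section ClosedSubspaces.
Context {R : realType} {H : completeNormedModType R[i]}.
Implicit Types (x y : H) (M X : set H) (S : H -> H).

Lemma csub0 M : closed_subspace M -> M 0. Proof. by case. Qed.
Lemma csubD M x y : closed_subspace M -> M x -> M y -> M (x + y).
Proof. by case=> _ h _ Mx My; rewrite -[x]scale1r; apply: h. Qed.
Lemma csubZ M (a : R[i]) x : closed_subspace M -> M x -> M (a *: x).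
Proof. by case=> M0 h _ Mx; rewrite -[_ *: _]addr0; apply: h. Qed.
Lemma csubN M x : closed_subspace M -> M x -> M (- x).
Proof. by move=> cM Mx; rewrite -scaleN1r; apply: csubZ. Qed.
Lemma csubB M x y : closed_subspace M -> M x -> M y -> M (x - y).
Proof. by move=> cM Mx My; apply: csubD => //; apply: csubN. Qed.
Lemma csub_sum M (I : eqType) (s : seq I) (F : I -> H) : closed_subspace M ->
  (forall i, i \in s -> M (F i)) -> M (\sum_(i <- s) F i).
Proof.
move=> cM h; rewrite big_seq; apply: (big_ind M) => //; first exact: csub0.
by move=> *; apply: csubD.
Qed.

Lemma csub_setT : closed_subspace [set: H].
Proof. by split. Qed.

Lemma csub_preimage S M : bop S -> closed_subspace M -> closed_subspace (S
  @^-1` M).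
Proof.
move=> bS cM; split => [|a x y Mx My|].
- by rewrite /preimage/= bop0//; apply: csub0.
- by rewrite /preimage/= bop_lin//; case: cM => _ h _; apply: h.
- apply/closed_approx => x xM; case: cM => _ _ /closed_approx cM.
  apply: cM => e e0; have [C C0 h] := bop_bound bS.
  have [y My xy] := xM _ (divr_gt0 e0 C0); exists (S y) => //.
  by move: xy; rewrite ltr_pdivlMr// mulrC -bopB//; apply: le_lt_trans.
Qed.

Lemma csub_bigcap (I : Type) (P : set I) (F : I -> set H) :
  (forall i, P i -> closed_subspace (F i)) ->
  closed_subspace (\bigcap_(i in P) F i).
Proof.
move=> cF; split => [i /cF/csub0//|a x y Fx Fy i Pi|].
  by have [_ h _] := cF _ Pi; apply: h; [apply: Fx|apply: Fy].
by apply: closed_bigI => i /cF[].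
Qed.

Lemma csub_set0 : closed_subspace [set (0 : H)].
Proof.
split=> // [a x y /= -> ->|]; first by rewrite scaler0 addr0.
apply/closed_approx => x h; apply/nrm_eq0/le_anti/andP; split;
  last exact: nrm_ge0.
apply/ler_addgt0Pr => e /h[y -> ]; rewrite subr0 => /ltW; lra.
Qed.

Lemma csub_null_space S : bop S -> closed_subspace (null_space S).
Proof. by move=> bS; apply: csub_preimage => //; apply: csub_set0. Qed.

Lemma csub_closed_span X : closed_subspace (closed_span X).
Proof.
rewrite (_ : closed_span X =
    \bigcap_(M in [set M | closed_subspace M /\ X `<=` M]) M).
  by apply: csub_bigcap => M [].
apply/seteqP; split => [x Xx M [cM XM]|x h M cM XM]; first exact: Xx.
exact: h.
Qed.

Lemma sub_closed_span X : X `<=` closed_span X.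
Proof. by move=> x Xx M _; apply. Qed.

Lemma closed_span_min X M : closed_subspace M -> X `<=` M -> closed_span X `<=`
  M.
Proof. by move=> cM XM x; apply. Qed.

Lemma closed_span_stable S X : bop S ->
  (forall x, X x -> closed_span X (S x)) ->
  forall x, closed_span X x -> closed_span X (S x).
Proof.
move=> bS h; apply: (@closed_span_min X (S @^-1` closed_span X)) => //.
by apply: csub_preimage => //; apply: csub_closed_span.
Qed.

End ClosedSubspaces.

(** * Orthogonal projection, Riesz representation and adjoints *)

Section Projections.
Context {R : realType} {H : completeNormedModType R[i]}.
Variable dot : {dot H for Num.conj}.
Hypothesis hdot : hilbert_dot dot.
Implicit Types (x y z : H) (M X : set H) (S : H -> H).

(** First-order condition for a shortest vector: if [d = dot y m] were nonzero, subtracting a small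
    positive multiple of [d *: m] would shorten [y]. *)
Lemma dot_eq0_min y m :
  (forall a : R[i], nrm y <= nrm (y - a *: m)) -> dot y m = 0.
Proof.
move=> h; apply: contrapT => /eqP d0; set d := dot y m in d0.
set s := complex.Re `|d|; have ds : `|d| = s%:C by rewrite RRe_real// ger0_real.
have s0 : 0 < s by rewrite -ltcR -ds normr_gt0.
have t0 : 0 < nrm m ^+ 2 + 1 by rewrite ltr_wpDl ?sqr_ge0.
(* This step size gives [t * nrm m ^+ 2 < 1], so the quadratic term stays below the linear gain. *)
pose t := (nrm m ^+ 2 + 1)^-1.
have := h (t%:C * d); rewrite -(ler_pXn2r (_ : 0 < 2)%N) ?nnegrE ?nrm_ge0//.
rewrite (sqr_nrmB hdot) nrmZ dotZr conjcM conjc_real -mulrA -/d.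
rewrite [d^*%C * d]mulrC -sqr_normc ds.
have -> : complex.Re `|t%:C * d| = `|t| * s by rewrite normrM ds normcR
  -rmorphM.
have -> : complex.Re (t%:C * s%:C ^+ 2) = t * s ^+ 2 by rewrite -rmorphXn
  -rmorphM.
have t1 : t * (nrm m ^+ 2 + 1) = 1 by rewrite mulVf ?gt_eqF.
have tt : 0 < t by rewrite invr_gt0.
rewrite (ger0_norm (ltW tt)).
have st : 0 < s ^+ 2 * t by rewrite mulr_gt0 ?exprn_gt0.
have -> : (t * s * nrm m) ^+ 2 = s ^+ 2 * t * (t * (nrm m ^+ 2 + 1) - t) by
  ring.
rewrite t1; nra.
Qed.

(** A sequence in [M] minimizing the distance to [x] is Cauchy by the parallelogram law, because
    midpoints stay in [M] and are at distance at least [d]. Its limit is the projection. *)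
Lemma projection_exists M x : closed_subspace M ->
  exists p, M p /\ forall m, M m -> dot (x - p) m = 0.
Proof.
move=> cM; pose D := [set nrm (x - m) | m in M].
have D0 : has_inf D.
  split; first by exists (nrm (x - 0)), 0 => //; apply: csub0.
  by exists 0 => _ [m _ <-]; apply: nrm_ge0.
pose d := inf D.
have dle m : M m -> d <= nrm (x - m).
  by move=> Mm; apply: ge_inf; [case: D0|exists m].
have d_ge0 : 0 <= d.
  by apply: lb_le_inf; [case: D0|move=> _ [m _ <-]; apply: nrm_ge0].
have /choice[u uP] n : exists m, M m /\ nrm (x - m) < d + n.+1%:R^-1.
  have n0 : (0 : R) < n.+1%:R^-1 by rewrite invr_gt0.
  by have [_ [m Mm <-] h] := inf_adherent n0 D0; exists m.
have uM n : M (u n) by have [] := uP n.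
have ud n : nrm (x - u n) < d + n.+1%:R^-1 by have [] := uP n.
have uC : seq_cauchy u.
  (* With both distances below [d + f] and [f <= 1], the parallelogram law bounds the squared gap by
     [4 (d + f)^2 - 4 d^2 <= f (8 d + 4)]. *)
  move=> e e0; have d1 : 0 < 8 * d + 4 by lra.
  have e2 : 0 < e ^+ 2 / (8 * d + 4) by rewrite divr_gt0// exprn_gt0.
  have e3 : 0 < Num.min (e ^+ 2 / (8 * d + 4)) 1 by rewrite lt_min e2/=.
  have [N hN] := inv_natS_lt e3; exists N => m n Nm Nn.
  set f := Num.min _ _ in e3 hN.
  have fe : f * (8 * d + 4) <= e ^+ 2.
    by rewrite -ler_pdivlMr// ge_min lexx.
  have f1 : f <= 1 by rewrite ge_min lexx orbT.
  rewrite -(ltr_pXn2r (_ : 0 < 2)%N) ?nnegrE ?nrm_ge0 ?(ltW e0)//.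
  have := parallelogram hdot (x - u m) (x - u n).
  have -> : x - u m - (x - u n) = - (u m - u n).
    by rewrite !opprB addrC subrKA.
  have -> : x - u m + (x - u n) = 2%:R%:C *: (x - 2^-1%:C *: (u m + u n)).
    rewrite scalerBr scalerA -rmorphM/= divff// scale1r opprD addrACA.
    by rewrite rmorphMn/= scaler_nat mulr2n.
  rewrite nrmN nrmZr ger0_norm//.
  have := dle (2^-1%:C *: (u m + u n)).
  have /[swap]/[apply] : M (2^-1%:C *: (u m + u n)) by apply: csubZ => //;
    apply: csubD.
  set q := nrm (x - _ *: _) => dq.
  have hm := lt_trans (ud m) (ler_ltD (lexx d) (hN _ Nm)).
  have hn := lt_trans (ud n) (ler_ltD (lexx d) (hN _ Nn)).
  have := dle _ (uM m); have := dle _ (uM n).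
  set a := nrm (x - u m) in hm *; set b := nrm (x - u n) in hn *.
  move=> da db eq.
  have a2 : a ^+ 2 < (d + f) ^+ 2 by rewrite ltr_pXn2r ?nnegrE//; lra.
  have b2 : b ^+ 2 < (d + f) ^+ 2 by rewrite ltr_pXn2r ?nnegrE//; lra.
  have q2 : d ^+ 2 <= q ^+ 2 by rewrite ler_pXn2r ?nnegrE//; lra.
  nra.
have [p up] := seq_cauchy_lim uC.
have Mp : M p by case: cM => _ _ cM; apply: closed_seq_lim cM uM up.
exists p; split => // m Mm; apply: dot_eq0_min => a.
apply: le_trans (_ : d <= _); last first.
  by rewrite -addrA -opprD; apply: dle; apply: csubD => //; apply: csubZ.
apply: (@nrm_seq_lim _ _ (fun n => x - u n)).
  by move=> e /up[N uN]; exists N => n /uN h; rewrite opprB addrC subrKA nrmC.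
move=> e /inv_natS_lt[N hN]; exists N => n /hN h.
by apply: ltW; apply: lt_trans (ud n) _; rewrite ltrD2l.
Qed.

Definition proj M x : H :=
  xget 0 [set p | M p /\ forall m, M m -> dot (x - p) m = 0].

Lemma projP M x : closed_subspace M ->
  M (proj M x) /\ forall m, M m -> dot (x - proj M x) m = 0.
Proof.
by move=> /(projection_exists x)/(xgetPex 0).
Qed.

Lemma proj_in M x : closed_subspace M -> M (proj M x).
Proof. by move=> /(projP x)[]. Qed.

Lemma proj_orth M x m : closed_subspace M -> M m -> dot (x - proj M x) m = 0.
Proof. by move=> /(projP x)[_]; apply. Qed.

Lemma proj_unique M x p : closed_subspace M -> M p ->
  (forall m, M m -> dot (x - p) m = 0) -> proj M x = p.
Proof.
move=> cM Mp h; have [Mq k] := projP x cM.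
apply/subr0_eq/(dotxx_eq0 hdot); have Mqp := csubB cM Mq Mp.
have e : (x - p) - (x - proj M x) = proj M x - p by rewrite opprB [LHS]addrC
  subrKA.
by rewrite -{1}e dotBl (h _ Mqp) (k _ Mqp) subrr.
Qed.

Lemma proj_id M x : closed_subspace M -> M x -> proj M x = x.
Proof. by move=> cM Mx; apply: proj_unique => // m _; rewrite subrr dot0l. Qed.

Lemma proj_lin M (a : R[i]) x y : closed_subspace M ->
  proj M (a *: x + y) = a *: proj M x + proj M y.
Proof.
move=> cM; apply: proj_unique => //.
  by case: (cM) => _ h _; apply: h; apply: proj_in.
move=> m Mm; rewrite opprD addrACA -scalerBr dotDl dotZl.
by rewrite !proj_orth// mulr0 addr0.
Qed.

Lemma nrm_proj_split M x : closed_subspace M ->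
  nrm x ^+ 2 = nrm (x - proj M x) ^+ 2 + nrm (proj M x) ^+ 2.
Proof.
move=> cM; rewrite -(pythagoras hdot); first by rewrite subrK.
by rewrite proj_orth//; apply: proj_in.
Qed.

Lemma nrm_proj M x : closed_subspace M -> nrm (proj M x) <= nrm x.
Proof.
move=> /(nrm_proj_split x) h.
by rewrite -(ler_pXn2r (_ : 0 < 2)%N) ?nnegrE ?nrm_ge0// h lerDr sqr_ge0.
Qed.

Lemma bop_proj M : closed_subspace M -> bop (proj M).
Proof.
move=> cM; apply: (@bopI _ _ _ 1) => [a x y|x]; first exact: proj_lin.
by rewrite mul1r nrm_proj.
Qed.

Lemma dot_projl M x m : closed_subspace M -> M m -> dot (proj M x) m = dot x m.
Proof.
move=> cM Mm; apply/esym/subr0_eq; rewrite -dotBl; exact: proj_orth.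
Qed.

Lemma dot_projr M x m : closed_subspace M -> M m -> dot m (proj M x) = dot m x.
Proof. by move=> cM Mm; rewrite dotC dot_projl// -dotC. Qed.

Lemma csub_dotl z : closed_subspace [set x | dot x z = 0].
Proof.
split => [|a x y /= hx hy|]; first exact: dot0l.
  by rewrite dotDl dotZl hx hy mulr0 addr0.
apply/closed_approx => x h; apply: contrapT => /eqP d0.
have s0 : 0 < complex.Re `|dot x z|.
  by rewrite -ltcR RRe_real ?normr_gt0// ger0_real.
have z1 : 0 < nrm z + 1 by rewrite ltr_wpDl ?nrm_ge0.
have [y yz] := h _ (divr_gt0 s0 z1).
rewrite ltr_pdivlMr//.
have := norm_dot_le hdot (x - y) z; rewrite dotBl yz subr0.
have := nrm_ge0 (x - y); have := nrm_ge0 z; nra.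
Qed.

Lemma csub_orth_compl X : closed_subspace (orth_compl dot X).
Proof.
rewrite (_ : orth_compl dot X = \bigcap_(z in X) [set x | dot x z = 0]).
  by apply: csub_bigcap => z _; apply: csub_dotl.
by apply/seteqP; split => x h y Xy; apply: h.
Qed.

Lemma orth_closed_span X x : (forall y, X y -> dot x y = 0) ->
  forall y, closed_span X y -> dot x y = 0.
Proof.
move=> h y Xy; apply: dot_eq0C; move: y Xy.
apply: (@closed_span_min _ _ X [set y | dot y x = 0]); first exact: csub_dotl.
by move=> y /h /dot_eq0C.
Qed.

Lemma orth_closed_spans X Y : orthogonal_sets dot X Y ->
  orthogonal_sets dot (closed_span X) (closed_span Y).
Proof.
move=> h x y Xx; apply: orth_closed_span => z Yz; move: x Xx.
apply: (@closed_span_min _ _ X [set x | dot x z = 0]); first exact: csub_dotl.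
by move=> x Xx; apply: h.
Qed.

Lemma csub_eqT M : closed_subspace M ->
  (forall x, (forall m, M m -> dot x m = 0) -> x = 0) -> forall x, M x.
Proof.
move=> cM h x; have -> : x = proj M x; last exact: proj_in.
by apply/subr0_eq/h => m Mm; apply: proj_orth.
Qed.

(** Riesz representation. A vector [w] orthogonal to the kernel with [f w] nonzero suffices:
    [x - (f x / f w) w] lies in the kernel, so a rescaling of [w] represents [f]; the scalar is
    conjugated because [dot] is conjugate-linear on the right. *)
Lemma riesz (f : H -> R[i]) (C : R) :
  (forall (a : R[i]) x y, f (a *: x + y) = a * f x + f y) ->
  (forall x, complex.Re `|f x| <= C * nrm x) ->
  exists z, forall x, f x = dot x z.
Proof.
move=> flin fC.
have f0 : f 0 = 0.
  have := flin 1 0 0; rewrite scaler0 addr0 mul1r => /eqP.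
  by rewrite -subr_eq subrr eq_sym => /eqP.
have fZ a x : f (a *: x) = a * f x by rewrite -[a *: x]addr0 flin f0 addr0.
have fB x y : f (x - y) = f x - f y by rewrite [x - y]addrC -scaleN1r flin
  mulN1r addrC.
have [k0|/existsNP[x0 fx0]] := pselect (forall x, f x = 0).
  by exists 0 => x; rewrite k0 dot0r.
pose K := [set x | f x = 0].
have cK : closed_subspace K.
  split => // [a x y /= fx fy|]; first by rewrite /K/= flin fx fy mulr0 addr0.
  apply/closed_approx => x h; apply: contrapT => /eqP d0.
  have s0 : 0 < complex.Re `|f x| by rewrite -ltcR RRe_real ?normr_gt0//
    ger0_real.
  have C1 : 0 < `|C| + 1 by rewrite ltr_wpDl.
  have [y fy] := h _ (divr_gt0 s0 C1).
  have := fC (x - y); rewrite fB fy subr0.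
  rewrite ltr_pdivlMr//; have := ler_norm C; have := nrm_ge0 (x - y); nra.
pose w := x0 - proj K x0.
have wK m : K m -> dot w m = 0 by apply: proj_orth.
have fw : f w = f x0 by rewrite fB (proj_in _ cK) subr0.
have w0 : w <> 0 by move=> w0; apply: fx0; rewrite -fw w0.
have dw : dot w w != 0 by apply/eqP => /(dotxx_eq0 hdot).
exists ((f w / dot w w)^*%C *: w) => x.
rewrite dotZr conjcK.
have kx : K (x - (f x / f w) *: w).
  rewrite /K/= fB fZ divfK ?subrr//.
  by rewrite fw; apply/eqP.
have /dot_eq0C := wK _ kx; rewrite dotBl dotZl => /subr0_eq ->.
have fw0 : f w != 0 by rewrite fw; apply/eqP.
by field; rewrite dw fw0.
Qed.

End Projections.

Section Adjoint.
Context {R : realType} {H : completeNormedModType R[i]}.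
Variable dot : {dot H for Num.conj}.
Hypothesis hdot : hilbert_dot dot.
Implicit Types (x y z : H) (M X : set H) (S : H -> H).

Definition is_adjoint M (N : set H) S (S' : H -> H) := bounded_op N M S' /\
    forall x y, M x -> N y -> dot (S x) y = dot x (S' y).

Lemma adjoint_exists_setT S : bop S -> exists S', is_adjoint setT setT S S'.
Proof.
move=> bS; have [C C0 hC] := bop_bound bS.
have /choice[S' hS'] y : exists z, forall x, dot (S x) y = dot x z.
  apply: (@riesz _ _ _ hdot (fun x => dot (S x) y) (C * nrm y)).
    by move=> a x z; rewrite (bop_lin _ _ _ bS) dotDl dotZl.
  move=> x; apply: le_trans (norm_dot_le hdot _ _) _.
  by rewrite mulrAC ler_wpM2r ?nrm_ge0.
exists S'; split => //; apply: (@bopI _ _ _ C).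
  move=> a x y; apply: (dot_ext hdot) => z; rewrite dotC -hS'.
  by rewrite dotDr dotZr !hS' -dotZr -dotDr -dotC.
move=> x; have [->|/eqP/nrm_gt0 s0] := eqVneq (S' x) 0.
  by rewrite nrm0 mulr_ge0 ?nrm_ge0// ltW.
rewrite -(ler_pM2l s0) -expr2 (sqr_nrm hdot) -hS'.
apply: le_trans (Re_dot_le hdot _ _) _; rewrite mulrA ler_wpM2r ?nrm_ge0//.
by rewrite mulrC.
Qed.

(** [S] is extended to all of [H] by precomposing with the projection onto [M]; the adjoint of the
    extension, projected onto [M], is an adjoint of [S]. *)
Lemma adjoint_exists M (N : set H) S : closed_subspace M -> closed_subspace N ->
  bounded_op M N S -> exists S', is_adjoint M N S S'.
Proof.
move=> cM cN bS.
have bSp : bop (fun x => S (proj dot M x)).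
  have [C C0 h] := op_bound bS; apply: (@bopI _ _ _ C) => [a x y|x].
    by rewrite (proj_lin hdot)//; case: bS => _ -> //; apply: proj_in.
  apply: le_trans (h _ (proj_in hdot _ cM)) _.
  by rewrite ler_pM2l// nrm_proj.
have [S' [bS' hS']] := adjoint_exists_setT bSp.
exists (fun y => proj dot M (S' y)); split.
  apply: bounded_op_sub (bop_comp (bop_proj hdot cM) bS') => // y _.
  exact: proj_in.
by move=> x y Mx Ny; rewrite (dot_projr hdot)// -hS'// (proj_id hdot).
Qed.

Lemma adjointP M (N : set H) S : closed_subspace M -> closed_subspace N ->
  bounded_op M N S -> is_adjoint M N S (adjoint dot M N S).
Proof.
by move=> cM cN /(adjoint_exists cM cN)/(xgetPex (fun=> 0)).
Qed.

(** [adjoint] is an arbitrary choice, so it is computed through uniqueness on [N]. *)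
Lemma adjointE M (N : set H) S S' y : closed_subspace M -> closed_subspace N ->
  bounded_op M N S -> is_adjoint M N S S' -> N y -> adjoint dot M N S y = S' y.
Proof.
move=> cM cN bS [bS' h'] Ny; have [bA h] := adjointP cM cN bS.
have Md : M (adjoint dot M N S y - S' y).
  by apply: csubB => //; [case: bA => + _ _|case: bS' => + _ _]; apply.
by apply/subr0_eq/(dotxx_eq0 hdot); rewrite dotBr -h// -h'// subrr.
Qed.

End Adjoint.

(** * Compactness and finite dimension *)

Section Compactness.
Context {R : realType} {H : completeNormedModType R[i]}.
Implicit Types (x y : H) (A K : set H) (S : H -> H).

Lemma compact_seq_cluster K (u : nat -> H) : compact K -> (forall n, K (u n)) ->
  exists2 p, K p &
    forall e : R, 0 < e -> forall N, exists2 n, (N <= n)%N & nrm (u n - p) < e.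
Proof.
move=> cK Ku; have [|p [Kp cp]] := cK (u @ \oo) _ _.
  by exists 0%N => // n _ /=.
exists p => // e e0 N; have e0C : 0 < e%:C by rewrite ltcR.
have [|_ [[n Nn <-]]] := cp [set u n | n in [set n | (N <= n)%N]] _ _
  (nbhsx_ballx p _ e0C).
  by exists N => // n Nn; exists n.
by rewrite ball_nrm nrmC => h; exists n.
Qed.

Lemma compact_no_separated K (u : nat -> H) (d : R) : compact K -> 0 < d ->
  (forall n, K (u n)) -> (forall m n, (m < n)%N -> d <= nrm (u m - u n)) ->
    False.
Proof.
move=> cK d0 Ku ud; have [p _ pu] := compact_seq_cluster cK Ku.
have d2 : 0 < d / 2 by rewrite divr_gt0.
have [m _ mp] := pu _ d2 0%N; have [n mn np] := pu _ d2 m.+1.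
have := ud _ _ mn; have := nrm_tri p (u m) (u n); rewrite (nrmC p); lra.
Qed.

Lemma compact_sum A K : compact A -> compact K ->
  compact [set x + y | x in A & y in K].
Proof.
move=> cA cK; rewrite (_ : [set _ | _ in _ & _ in _] =
    (fun z : H * H => z.1 + z.2) @` (A `*` K)).
  apply: continuous_compact; last exact: compact_setX.
  by apply: continuous_subspaceT => z; apply: add_continuous.
apply/seteqP; split => [_ [x Ax [y Ky <-]]|_ [[x y] [Ax Ky] <-]].
  by exists (x, y).
by exists x => //; exists y.
Qed.

Lemma compact_bop S K : bop S -> compact K -> compact (S @` K).
Proof.
move=> bS cK; apply: continuous_compact => //.
by apply: continuous_subspaceT => x; apply: bop_continuous.
Qed.

Lemma compact_real_segment x (r : R) :
  compact [set t%:C *: x | t in `[- r, r]%classic].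
Proof.
apply: (@continuous_compact R H (fun t => t%:C *: x));
  last exact: segment_compact.
apply: continuous_subspaceT => t; apply/cvgrPdist_lt => _ /gt0_complex[e e0 ->].
have x1 : 0 < nrm x + 1 by rewrite ltr_wpDl ?nrm_ge0.
have e1 : 0 < e / (nrm x + 1) by rewrite divr_gt0.
near=> s; rewrite -scalerBl -rmorphB/= normE ltcR nrmZr.
have : `|t - s| < e / (nrm x + 1).
  by near: s; apply: (@cvgr_dist_lt _ R^o).
by rewrite ltr_pdivlMr//; apply: le_lt_trans; rewrite ler_wpM2l// lerDl.
Unshelve. all: by end_near. Qed.

(** Splitting the scalar into real and imaginary parts covers the disk by the sum of two real
    segments, along [x] and along ['i *: x]. *)
Lemma compact_disk x (r : R) : exists2 K, compact K &
  forall a : R[i], complex.Re `|a| <= r -> K (a *: x).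
Proof.
exists [set y + z | y in [set t%:C *: x | t in `[- r, r]%classic] &
    z in [set t%:C *: ('i *: x) | t in `[- r, r]%classic]].
  by apply: compact_sum; apply: compact_real_segment.
move=> [p q]; rewrite normc_def/= => pq.
have pr : `|p| <= r.
  by apply: le_trans pq; rewrite -sqrtr_sqr ler_wsqrtr// lerDl sqr_ge0.
have qr : `|q| <= r.
  by apply: le_trans pq; rewrite -sqrtr_sqr ler_wsqrtr// lerDr sqr_ge0.
exists (p%:C *: x); first by exists p => //; rewrite /= in_itv/= -ler_norml.
exists (q%:C *: ('i *: x)); first by exists q => //;
  rewrite /= in_itv/= -ler_norml.
by rewrite scalerA -scalerDl; congr (_ *: _); simpc.
Qed.

Lemma compact_op_ball S : compact_op S -> exists2 K, compact K &
  forall x, nrm x <= 1 -> K (S x).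
Proof.
case=> _; rewrite precompactE => cS; eexists; first exact: cS.
move=> x x1; apply: subset_closure; exists x => //=.
by rewrite normE lecR.
Qed.

(** The image of the unit ball lies within any [e] of a compact set, hence is totally bounded. The
    argument shows that every ultrafilter on its closure is Cauchy. *)
Lemma compact_op_approx S : bop S ->
  (forall e : R, 0 < e -> exists2 K, compact K &
    forall x, nrm x <= 1 -> exists2 y, K y & nrm (S x - y) <= e) ->
  compact_op S.
Proof.
move=> bS h; split => //; rewrite precompactE; set A := S @` _.
rewrite compact_ultra => F FU FA.
suff /cvg_ex[p Fp] : cvg F.
  exists p; split => //.
  move=> B Bp; have [q [clq Bq]] := filter_ex (filterI FA (Fp _ (nbhs_interior
    Bp))).
  have [z [Az Bz]] := clq _ Bq.
  by exists z; split.
apply: cauchy_cvg; apply: cauchy_exP => _ /gt0_complex[r r0 ->].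
have r3 : 0 < r / 3 by rewrite divr_gt0.
have [K cK hK] := h _ r3.
(* [f] moves a point of the closure to a nearby point of [K]; the image ultrafilter then clusters at
   some [p] in [K]. *)
have /choice[f hf] x : exists y, closure A x -> K y /\ nrm (x - y) < 2 * (r /
  3).
  have [clx|?] := pselect (closure A x); last by exists 0.
  have r3C : 0 < (r / 3)%:C by rewrite ltcR.
  have [_ [[x' x'1 <-]]] := clx _ (nbhsx_ballx x _ r3C).
  rewrite ball_nrm => xx'; move: x'1; rewrite /= normE lecR => x'1.
  have [y Ky Sy] := hK _ x'1; exists y => _; split => //.
  by apply: le_lt_trans (nrm_tri (S x') _ _) _; lra.
have [|p [Kp cp]] := cK (f @ F) _ _.
  by apply: (@filterS _ F _ (closure A) (f @^-1` K)) => // x /hf[].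
exists p; have r3C : 0 < (r / 3)%:C by rewrite ltcR.
(* An ultrafilter contains this preimage or its complement; the complement would contradict that [p]
   is a cluster point. *)
have [Fb|] := in_ultra_setVsetC (f @^-1` ball p (r / 3)%:C) FU.
  apply: (@filterS _ F _ (closure A `&` f @^-1` ball p (r / 3)%:C));
    last exact: filterI.
  move=> x [/hf[_ xf]]; rewrite /= !ball_nrm => fp.
  by apply: le_lt_trans (nrm_tri (f x) _ _) _; rewrite (nrmC (f x)); lra.
move=> Fn; have [z [nz bz]] := cp (~` ball p (r / 3)%:C) _ Fn (nbhsx_ballx p _
  r3C).
by have := nz bz.
Qed.

End Compactness.

Section FiniteDimension.
Context {R : realType} {H : completeNormedModType R[i]}.
Variable dot : {dot H for Num.conj}.
Hypothesis hdot : hilbert_dot dot.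
Implicit Types (x y v w : H) (s : seq H) (X M : set H).

Fixpoint orthonormal_list s : Prop :=
  if s is v :: s' then
    [/\ nrm v = 1, forall w, w \in s' -> dot v w = 0 & orthonormal_list s']
  else True.

(** For orthonormal [s], the orthogonal projection onto its span, so that [list_proj s x = x]
    expresses membership in the span. *)
Definition list_proj s x : H := \sum_(v <- s) dot x v *: v.

Lemma list_proj_cons v s x : list_proj (v :: s) x = dot x v *: v + list_proj s
  x.
Proof. by rewrite /list_proj big_cons. Qed.

Lemma dot_list_proj0 s x y : (forall w, w \in s -> dot w y = 0) ->
  dot (list_proj s x) y = 0.
Proof.
move=> h; rewrite /list_proj dot_suml big_seq big1// => w /h.
by rewrite dotZl => ->; rewrite mulr0.
Qed.

Lemma list_proj_orth s x v : orthonormal_list s -> v \in s ->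
  dot (x - list_proj s x) v = 0.
Proof.
move=> os vs; apply/eqP; rewrite dotBl subr_eq0 eq_sym; apply/eqP.
elim: s os vs => // w s IH [w1 ws os]; rewrite in_cons list_proj_cons dotDl
  dotZl.
case/predU1P => [->|vs]; last by rewrite ws// mulr0 add0r IH.
rewrite (dotxx hdot) w1 expr1n mulr1 dot_list_proj0 ?addr0// => u us.
by apply: dot_eq0C; apply: ws.
Qed.

Lemma bop_dotl v y : bop (fun x : H => dot x v *: y).
Proof.
apply: (@bopI _ _ _ (nrm v * nrm y)) => [a x z|x].
  by rewrite dotDl dotZl scalerDl scalerA.
by rewrite nrmZ mulrAC ler_wpM2r ?nrm_ge0// mulrC norm_dot_le.
Qed.

Lemma bop_list_proj s : bop (list_proj s).
Proof.
elim: s => [|v s IH].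
  rewrite (_ : list_proj _ = fun=> 0); last first.
    by apply/funext => x; rewrite /list_proj big_nil.
  by apply: (@bopI _ _ _ 0) => [a x y|x]; rewrite ?scaler0 ?addr0// nrm0 mul0r.
rewrite (_ : list_proj _ = fun x => dot x v *: v + list_proj s x); last first.
  by apply/funext => x; rewrite list_proj_cons.
by apply: bop_add => //; apply: bop_dotl.
Qed.

(** Each vector contributes its normalized residual, unless it already lies in the span of the
    previous ones. *)
Lemma gram_schmidt (l : seq H) :
  exists2 s, orthonormal_list s & forall v, v \in l -> list_proj s v = v.
Proof.
elim: l => [|v l [s os hs]]; first by exists [::].
have [e|ne] := pselect (list_proj s v = v).
  by exists s => // w; rewrite in_cons => /predU1P[->|/hs].
set w := v - list_proj s v.
have ws u : u \in s -> dot w u = 0 by apply: list_proj_orth.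
have w0 : 0 < nrm w by apply: nrm_gt0 => /subr0_eq/esym.
exists ((nrm w)^-1%:C *: w :: s).
  split => // [|u us]; last by rewrite dotZl ws// mulr0.
  by rewrite nrmZr ger0_norm ?invr_ge0 ?nrm_ge0// mulVf// gt_eqF.
have dw u : dot (list_proj s u) w = 0.
  by apply: dot_list_proj0 => z zs; apply: dot_eq0C; apply: ws.
move=> u; rewrite in_cons list_proj_cons => /predU1P[->|ul]; last first.
  by rewrite dotZrr -{1}(hs _ ul) dw mulr0 scale0r add0r hs.
rewrite dotZrr -{1}(subrK (list_proj s v) v) -/w dotDl dw addr0 (dotxx hdot).
rewrite scalerA -!rmorphM/= (_ : _ * _ = 1) ?scale1r ?subrK//.
by rewrite expr2 mulKf ?divff ?gt_eqF.
Qed.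

(** The fixed vectors of [list_proj s] form a closed subspace, so passing to the closed span adds
    nothing beyond the finite dimensional span. *)
Lemma finite_dim_basis X : finite_dim X ->
  exists2 s, orthonormal_list s & forall x, closed_span X x -> list_proj s x =
    x.
Proof.
move=> [n [e he]]; have [s os hs] := gram_schmidt (codom e).
exists s => // x; suff h : closed_span X `<=` null_space (fun x => list_proj s
  x - x).
  by move/h => /subr0_eq.
apply: closed_span_min.
  by apply: csub_null_space; apply: bop_sub;
    [apply: bop_list_proj|apply: bop_id].
move=> {}x /he[c ->]; rewrite /null_space/= /preimage/=.
rewrite (bop_sum _ _ (bop_list_proj s)) -sumrB big1// => i _.
by rewrite (bopZ _ _ (bop_list_proj s)) hs ?subrr// codom_f.
Qed.

Lemma finite_dim_list_proj X s : (forall x, X x -> list_proj s x = x) ->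
  finite_dim X.
Proof.
move=> h; exists (size s), (fun i => nth 0 s i) => x /h <-.
exists (fun i => dot x (nth 0 s i)).
by rewrite /list_proj (big_nth 0) big_mkord.
Qed.

Lemma finite_dim_closed_span X : finite_dim X -> finite_dim (closed_span X).
Proof. by move=> /finite_dim_basis[s _]; apply: finite_dim_list_proj. Qed.

Lemma finite_dim_sub X (Y : set H) : X `<=` Y -> finite_dim Y -> finite_dim X.
Proof. by move=> XY [n [e h]]; exists n, e => x /XY/h. Qed.

Lemma finite_dimU X (Y : set H) : finite_dim X -> finite_dim Y -> finite_dim (X
  `|` Y).
Proof.
move=> [n [e h]] [m [f k]].
exists (n + m)%N, (fun i => match fintype.split i with inl i => e i | inr j =>
  f j end).
move=> x [/h[c ->]|/k[c ->]].
  exists (fun i => match fintype.split i with inl i => c i | inr j => 0 end).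
  rewrite big_split_ord/= [X in _ + X]big1 ?addr0.
    by apply: eq_bigr => i _; rewrite (unsplitK (inl i)).
  by move=> i _; rewrite (unsplitK (inr i)) scale0r.
exists (fun i => match fintype.split i with inl i => 0 | inr j => c j end).
rewrite big_split_ord/= [X in X + _]big1 ?add0r.
  by apply: eq_bigr => i _; rewrite (unsplitK (inr i)).
by move=> i _; rewrite (unsplitK (inl i)) scale0r.
Qed.

Lemma finite_dim_image M (S : H -> H) : bop S -> finite_dim M -> finite_dim (S
  @` M).
Proof.
move=> bS [n [e h]]; exists n, (S \o e) => _ [x /h[c ->] <-].
by exists c; rewrite (bop_sum _ _ bS); apply: eq_bigr => i _;
  rewrite (bopZ _ _ bS).
Qed.

(** Coordinates in an orthonormal basis are bounded by [r], so the ball lies in a finite sum of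
    compact disks. *)
Lemma finite_dim_ball_compact X (r : R) : finite_dim X ->
  exists2 K, compact K & forall x, X x -> nrm x <= r -> K x.
Proof.
move=> /finite_dim_basis[s os hs].
have [K cK hK] : exists2 K, compact K & forall x, nrm x <= r -> K (list_proj s
  x).
  elim: s os {hs} => [|v s IH] /=.
    exists [set 0]; first exact: compact_set1.
    by move=> x _; rewrite /list_proj big_nil.
  move=> [v1 _ /IH[K cK hK]]; have [D cD hD] := compact_disk v r.
  exists [set x + y | x in D & y in K]; first exact: compact_sum.
  move=> x xr; rewrite list_proj_cons; exists (dot x v *: v).
    apply: hD; apply: le_trans (norm_dot_le hdot _ _) _.
    by rewrite v1 mulr1.
  by exists (list_proj s x) => //; apply: hK.
exists K => // x Xx /hK; rewrite hs//; exact: sub_closed_span.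
Qed.

Definition orthonormal_seq (g : nat -> H) :=
  (forall n, nrm (g n) = 1) /\ forall m n, m <> n -> dot (g m) (g n) = 0.

Lemma orthonormal_seq_separated g : orthonormal_seq g ->
  forall m n, (m < n)%N -> 1 <= nrm (g m - g n).
Proof.
move=> [g1 g0] m n mn; rewrite -(@ler_pXn2r _ 2)// ?nnegrE ?nrm_ge0//.
rewrite (sqr_nrmB hdot) !g1 g0/=; last by apply/eqP; rewrite ltn_eqF.
by lra.
Qed.

Lemma compact_no_orthonormal (K : set H) g : compact K -> orthonormal_seq g ->
  (forall n, K (g n)) -> False.
Proof.
move=> cK og Kg; apply: (compact_no_separated cK ltr01 Kg).
exact: orthonormal_seq_separated.
Qed.

Lemma finite_dim_no_orthonormal X g : finite_dim X -> orthonormal_seq g ->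
  (forall n, X (g n)) -> False.
Proof.
move=> fX og Xg; have [K cK hK] := finite_dim_ball_compact 1 fX.
apply: (compact_no_orthonormal cK og) => n; apply: hK => //.
by case: og => ->.
Qed.

Lemma greedy_orthonormal X :
  (forall s, orthonormal_list s -> (forall v, v \in s -> X v) ->
    exists v, [/\ X v, nrm v = 1 & forall w, w \in s -> dot v w = 0]) ->
  exists2 g, orthonormal_seq g & forall n, X (g n).
Proof.
move=> h.
have /choice[f hf] s : exists v, orthonormal_list s -> (forall v, v \in s -> X
  v) ->
    [/\ X v, nrm v = 1 & forall w, w \in s -> dot v w = 0].
  have [[os Xs]|n] := pselect (orthonormal_list s /\ forall v, v \in s -> X v).
    by have [v hv] := h _ os Xs; exists v.
  by exists 0 => os Xs; case: n.
(* [L n] holds the first [n] chosen vectors, newest first; the resulting sequence is [f (L n)]. *)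
pose L := fix L n := if n is n'.+1 then f (L n') :: L n' else [::].
have LP n : orthonormal_list (L n) /\ forall v, v \in L n -> X v.
  elim: n => //= n [oL XL]; have [Xf f1 f0] := hf _ oL XL; split => // v.
  by rewrite in_cons => /predU1P[->|/XL].
have fL m n : (m < n)%N -> f (L m) \in L n.
  elim: n => // n IH; rewrite ltnS leq_eqVlt => /predU1P[->|/IH] /=.
    by rewrite in_cons eqxx.
  by rewrite in_cons orbC => ->.
exists (fun n => f (L n)); last by move=> n; have [oL XL] := LP n;
  case: (hf _ oL XL).
split=> [n|m n /eqP]; first by have [oL XL] := LP n; case: (hf _ oL XL).
rewrite neq_ltn => /orP[mn|nm].
  by apply: dot_eq0C; have [oL XL] := LP n; case: (hf _ oL XL) => _ _; apply;
    apply: fL.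
by have [oL XL] := LP m; case: (hf _ oL XL) => _ _; apply; apply: fL.
Qed.

Lemma infinite_dim_orthonormal M : closed_subspace M -> ~ finite_dim M ->
  exists2 g, orthonormal_seq g & forall n, M (g n).
Proof.
move=> cM iM; apply: greedy_orthonormal => s os Ms.
have /existsNP[x /not_implyP[Mx xs]] : ~ forall x, M x -> list_proj s x = x.
  by move=> /finite_dim_list_proj.
have w0 : 0 < nrm (x - list_proj s x) by apply: nrm_gt0 => /subr0_eq/esym.
exists ((nrm (x - list_proj s x))^-1%:C *: (x - list_proj s x)); split.
- apply: csubZ => //; apply: csubB => //; apply: csub_sum => // v vs.
  by apply: csubZ => //; apply: Ms.
- by rewrite nrmZr ger0_norm ?invr_ge0 ?nrm_ge0// mulVf// gt_eqF.
- by move=> w ws; rewrite dotZl list_proj_orth// mulr0.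
Qed.

End FiniteDimension.

(** * Square roots of positive operators *)

Section SquareRoot.
Context {R : realType} {H : completeNormedModType R[i]}.
Variable dot : {dot H for Num.conj}.
Hypothesis hdot : hilbert_dot dot.
Implicit Types (x y : H).

Definition selfadjoint (S : H -> H) := forall x y, dot (S x) y = dot x (S y).

(* The case [D = id] of [op_iter] below, which majorizes its increments. *)
Fixpoint scalar_iter n : R :=
  if n is n'.+1 then (1 + scalar_iter n' ^+ 2) / 2 else 0.

Lemma scalar_iter_bounds n : 0 <= scalar_iter n <= 1.
Proof. by elim: n => [|n /andP[a0 a1]] /=; [rewrite lexx ler01|nra]. Qed.

Lemma scalar_iter_incr n : scalar_iter n <= scalar_iter n.+1.
Proof.
elim: n => [|n IH]; first by rewrite /= expr0n/=; lra.
have /andP[a0 _] := scalar_iter_bounds n.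
have /andP[b0 _] := scalar_iter_bounds n.+1.
by apply: ler_wpM2r => //; rewrite lerD2l ler_pXn2r.
Qed.

Lemma scalar_iter_cauchy (e : R) : 0 < e -> exists N, forall m n,
  (N <= n)%N -> (n <= m)%N -> scalar_iter m - scalar_iter n < e.
Proof.
move=> e0; have A0 : has_sup (range scalar_iter).
  split; first by exists (scalar_iter 0), 0%N.
  by exists 1 => _ [n _ <-]; have /andP[] := scalar_iter_bounds n.
have [_ [N _ <-] hN] := sup_adherent e0 A0; exists N => m n Nn nm.
have : scalar_iter m <= sup (range scalar_iter).
  by apply: ub_le_sup; [case: A0|exists m].
have : scalar_iter N <= scalar_iter n.
  by apply: (@nondecreasing_seqP _ R scalar_iter).1 => //;
    apply: scalar_iter_incr.
by lra.
Qed.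

Section Iteration.
Variable D : H -> H.
Hypothesis bD : bop D.
Hypothesis D1 : forall x, nrm (D x) <= nrm x.
Hypothesis Dsa : selfadjoint D.

(** Iteration from [0] for [Y = (D + Y^2) / 2], an equation equivalent to [(1 - Y)^2 = 1 - D]. *)
Fixpoint op_iter n : H -> H :=
  if n is n'.+1 then fun x => 2^-1%:C *: (D x + op_iter n' (op_iter n' x))
  else fun=> 0.

Lemma bop_op_iter n : bop (op_iter n).
Proof.
elim: n => [|n IH] /=.
  by apply: (@bopI _ _ _ 0) => [a x y|x]; rewrite ?scaler0 ?addr0// nrm0 mul0r.
by apply: bop_scale; apply: bop_add => //; apply: bop_comp.
Qed.

Lemma op_iter_selfadjoint n : selfadjoint (op_iter n).
Proof.
elim: n => [|n IH] x y /=; first by rewrite dot0l dot0r.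
by rewrite dotZl dotZrr dotDl dotDr Dsa !IH.
Qed.

Lemma nrm_op_iter n x : nrm (op_iter n x) <= scalar_iter n * nrm x.
Proof.
elim: n x => [|n IH] x /=; first by rewrite nrm0 mul0r.
rewrite nrmZr ger0_norm ?invr_ge0// mulrC mulrAC ler_pM2r//.
apply: le_trans (nrmD _ _) _; rewrite mulrDl mul1r lerD//.
have /andP[a0 _] := scalar_iter_bounds n.
by apply: le_trans (IH _) _; rewrite expr2 -mulrA ler_wpM2l.
Qed.

Lemma nrm_op_iter_le n x : nrm (op_iter n x) <= nrm x.
Proof.
apply: le_trans (nrm_op_iter n x) _; have /andP[_ a1] := scalar_iter_bounds n.
by rewrite ler_piMl ?nrm_ge0.
Qed.

(** With [Y] and [Y'] consecutive iterates, [Y'^2 - Y^2 = Y' (Y' - Y) + (Y' - Y) Y], and every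
    factor is bounded by its scalar counterpart. *)
Lemma op_iter_step n x : nrm (op_iter n.+1 x - op_iter n x) <=
  (scalar_iter n.+1 - scalar_iter n) * nrm x.
Proof.
elim: n x => [|n IH] x.
  rewrite !subr0; exact: (nrm_op_iter 1 x).
set d := scalar_iter n.+1 - scalar_iter n in IH.
have d0 : 0 <= d by rewrite subr_ge0 scalar_iter_incr.
have /andP[a0 _] := scalar_iter_bounds n.+1.
have -> : op_iter n.+2 x - op_iter n.+1 x = 2^-1%:C *:
    (op_iter n.+1 (op_iter n.+1 x - op_iter n x) +
      (op_iter n.+1 (op_iter n x) - op_iter n (op_iter n x))).
  rewrite (bopB _ _ (bop_op_iter n.+1)) subrKA.
  rewrite [op_iter n.+2 x]/= [in X in _ - X]/= -scalerBr; congr (_ *: _).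
  by rewrite [D x + _]addrC addrKA.
rewrite nrmZr ger0_norm ?invr_ge0//.
have -> : scalar_iter n.+2 - scalar_iter n.+1 =
    2^-1 * (scalar_iter n.+1 * d + d * scalar_iter n).
  have e m : scalar_iter m.+1 = (1 + scalar_iter m ^+ 2) / 2 by [].
  by have := e n; rewrite /d (e n.+1); lra.
rewrite -mulrA ler_pM2l ?invr_gt0//; apply: le_trans (nrmD _ _) _.
rewrite mulrDl lerD//.
  by apply: le_trans (nrm_op_iter _ _) _; rewrite -mulrA ler_wpM2l.
by apply: le_trans (IH _) _; rewrite -mulrA ler_wpM2l// nrm_op_iter.
Qed.

Lemma op_iter_diff m n x : (n <= m)%N -> nrm (op_iter m x - op_iter n x) <=
  (scalar_iter m - scalar_iter n) * nrm x.
Proof.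
elim: m => [|m IH]; first by rewrite leqn0 => /eqP->; rewrite !subrr nrm0 mul0r.
rewrite leq_eqVlt => /predU1P[->|]; first by rewrite !subrr nrm0 mul0r.
rewrite ltnS => /IH {}IH.
apply: le_trans (nrm_tri (op_iter m x) _ _) _.
apply: le_trans (lerD (op_iter_step m x) IH) _.
by rewrite -mulrDl subrKA.
Qed.

Lemma op_iter_lim : exists Y : H -> H, forall x, seq_lim (op_iter ^~ x) (Y x).
Proof.
suff /choice[Y hY] x : exists l, seq_lim (op_iter ^~ x) l by exists Y.
apply: seq_cauchy_lim => e e0.
have x1 : 0 < nrm x + 1 by rewrite ltr_wpDl ?nrm_ge0.
have [N hN] := scalar_iter_cauchy (divr_gt0 e0 x1).
have main m n : (N <= n)%N -> (n <= m)%N -> nrm (op_iter m x - op_iter n x) < e.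
  move=> Nn nm; apply: le_lt_trans (op_iter_diff x nm) _.
  have := hN _ _ Nn nm; rewrite ltr_pdivlMr//; apply: le_lt_trans.
  rewrite ler_wpM2l ?lerDl// subr_ge0.
  by apply: (@nondecreasing_seqP _ R scalar_iter).1 => //;
    apply: scalar_iter_incr.
exists N => m n Nm Nn; have [mn|/ltnW nm] := leqP m n; last exact: main.
by rewrite nrmC; apply: main.
Qed.

(** Self-adjointness of the limit is recorded as reality of [dot (Y x) x]; together with
    [nrm (Y x) <= nrm x] this makes [1 - Y] positive. *)
Lemma one_sub_sqrt_exists : exists Y : H -> H, [/\ bop Y,
  forall x, nrm (Y x) <= nrm x, forall x, complex.Im (dot (Y x) x) = 0
  & forall x, Y x = 2^-1%:C *: (D x + Y (Y x))].
Proof.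
have [Y hY] := op_iter_lim.
have Y1 x : nrm (Y x) <= nrm x.
  apply: nrm_seq_lim (hY x) _ => e e0; exists 0%N => n _.
  by apply: ler_wpDr; [exact: ltW|exact: nrm_op_iter_le].
have bY : bop Y.
  apply: (@bopI _ _ _ 1) => [a x y|x]; last by rewrite mul1r.
  apply: seq_lim_unique (hY _) _.
  rewrite (_ : (fun n => _) = fun n => a *: op_iter n x + op_iter n y).
    apply: seq_limD => //; apply: (bop_seq_lim (S := fun z => a *: z)) => //.
    by apply: bop_scale; apply: bop_id.
  by apply/funext => n; rewrite (bop_lin _ _ _ (bop_op_iter n)).
exists Y; split => //.
  move=> x; apply/normr0_eq0/le_anti/andP; split; last exact: normr_ge0.
  apply/ler_addgt0Pr => e e0; rewrite add0r.
  have x1 : 0 < nrm x + 1 by rewrite ltr_wpDl ?nrm_ge0.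
  have [N /(_ N (leqnn N)) hN] := hY x _ (divr_gt0 e0 x1).
  have r0 : complex.Im (dot (op_iter N x) x) = 0.
    have := op_iter_selfadjoint N x x; rewrite [RHS](dotC dot).
    by case: (dot (op_iter N x) x) => p q [/eqP];
      rewrite -addr_eq0 -mulr2n mulrn_eq0 => /eqP.
  have -> : complex.Im (dot (Y x) x) = complex.Im (dot (Y x - op_iter N x) x).
    by rewrite dotBl raddfB/= r0 subr0.
  apply: le_trans (_ : complex.Re `|dot (Y x - op_iter N x) x| <= _).
    case: (dot _ _) => p q; rewrite normc_def/=.
    by rewrite -sqrtr_sqr ler_wsqrtr// lerDr sqr_ge0.
  apply: le_trans (norm_dot_le hdot _ _) _; rewrite nrmC.
  move: hN; rewrite ltr_pdivlMr// => /ltW; apply: le_trans.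
  by rewrite ler_wpM2l ?nrm_ge0// lerDl.
move=> x; apply: seq_lim_unique (seq_limS (hY x)) _.
apply: (bop_seq_lim (S := fun z => 2^-1%:C *: z)).
  by apply: bop_scale; apply: bop_id.
apply: seq_limD.
  by move=> e e0; exists 0%N => n _; rewrite subrr nrm0.
move=> e e0; have e2 : 0 < e / 2 by rewrite divr_gt0.
have [N1 h1] := hY x _ e2; have [N2 h2] := hY (Y x) _ e2.
exists (maxn N1 N2) => n; rewrite geq_max => /andP[/h1 {}h1 /h2 {}h2].
apply: le_lt_trans (nrm_tri (op_iter n (Y x)) _ _) _.
rewrite -(bopB _ _ (bop_op_iter n)).
have := nrm_op_iter_le n (op_iter n x - Y x); lra.
Qed.

End Iteration.

(** The last hypothesis expresses [0 <= Q <= c]. It makes [D = 1 - Q / c] a contraction, and the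
    root is [sqrt c] times [1 - Y]. *)
Lemma sqrt_op_exists (Q : H -> H) (c : R) : bop Q -> selfadjoint Q -> 0 < c ->
  (forall x, nrm (Q x) ^+ 2 <= c * complex.Re (dot (Q x) x)) ->
  exists P, [/\ bop P, op_le dot setT (fun=> 0) P & forall x, P (P x) = Q x].
Proof.
move=> bQ sQ c0 Qc; pose D x := x - c^-1%:C *: Q x.
have bD : bop D by apply: bop_sub; [apply: bop_id|apply: bop_scale].
have sD : selfadjoint D.
  by move=> x y; rewrite /D dotBl dotBr dotZl dotZrr sQ.
have ReZ (r : R) (a : R[i]) : complex.Re (r%:C * a) = r * complex.Re a.
  by case: a => p q; simpc.
have D1 x : nrm (D x) <= nrm x.
  rewrite -(@ler_pXn2r _ 2)// ?nnegrE ?nrm_ge0// (sqr_nrmB hdot) dotZrr ReZ.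
  rewrite nrmZr ger0_norm ?invr_ge0 ?(ltW c0)// exprMn -(sQ x).
  have ci : 0 < c^-1 by rewrite invr_gt0.
  have := Qc x; set r := complex.Re _; set n2 := nrm _ ^+ 2 => n2r.
  have n20 : 0 <= n2 by apply: sqr_ge0.
  have h : c^-1 * n2 <= r by rewrite mulrC ler_pdivrMr// mulrC.
  have h0 : 0 <= c^-1 * n2 by rewrite mulr_ge0// ltW.
  have : c^-1 ^+ 2 * n2 <= c^-1 * r by rewrite expr2 -mulrA ler_pM2l.
  have : 0 <= c^-1 * r by apply: mulr_ge0; [exact: ltW|exact: le_trans h0 h].
  lra.
have [Y [bY Y1 YIm Yeq]] := one_sub_sqrt_exists bD D1 sD.
pose s := Num.sqrt c.
have ss : s * s = c by rewrite -expr2 sqr_sqrtr// ltW.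
exists (fun x => s%:C *: (x - Y x)); split.
- by apply: bop_scale; apply: bop_sub => //; apply: bop_id.
- move=> x _; rewrite dot0l dotZl dotBl (dotxx hdot).
  have := Re_dot_le hdot (Y x) x; have := YIm x.
  case: (dot (Y x) x) => p q /= -> pxx.
  have : p <= nrm x ^+ 2.
    by apply: le_trans pxx _; rewrite expr2 ler_wpM2r ?nrm_ge0.
  rewrite lecE; simpc => px.
  by rewrite /= mulr_ge0 ?sqrtr_ge0 ?subr_ge0// eqxx.
- move=> x; rewrite (bopZ _ _ bY) (bopB _ _ bY) -scalerBr scalerA -rmorphM/= ss.
  have e : Y (Y x) = 2%:R%:C *: Y x - D x.
    rewrite {2}(Yeq x) scalerA -rmorphM/= divff// scale1r addrC addKr//.
  have two : 2%:R%:C *: Y x = Y x + Y x by rewrite rmorphMn/= scaler_nat mulr2n.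
  have -> : x - Y x - (Y x - Y (Y x)) = c^-1%:C *: Q x.
    have f : Y x - (Y x + Y x - D x) = D x - Y x.
      by rewrite opprB opprD [LHS]addrC addrA subrK.
    by rewrite e two f opprB subrKA /D opprB [LHS]addrC subrK.
  by rewrite scalerA -rmorphM/= divff ?gt_eqF// scale1r.
Qed.

(** Polarization: the form [B], which measures the failure of self-adjointness, vanishes on the
    diagonal. At [x + y] this gives [B x y = - B y x], at ['i x + y] it gives [B x y = B y x]. *)
Lemma positive_selfadjoint P : bop P -> op_le dot setT (fun=> 0) P ->
  selfadjoint P.
Proof.
move=> bP pP; pose B x y := dot (P x) y - dot x (P y).
have B0 x : B x x = 0.
  rewrite /B [dot x _](dotC dot); have := pP x I; rewrite dot0l lecE/=.
  case: (dot (P x) x) => p q /= /andP[/eqP-> _]; apply/eqP.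
  by rewrite eq_complex/= subrr !oppr0 addr0 !eqxx.
have BD x y : B (x + y) (x + y) = B x x + B y y + (B x y + B y x).
  rewrite /B !(bopD _ _ bP) !(dotDl, dotDr).
  ring.
have BZ x y : B ('i *: x) y = 'i * B x y.
  by rewrite /B (bopZ _ _ bP) !dotZl mulrBr.
have BZr x y : B y ('i *: x) = - 'i * B y x.
  rewrite /B (bopZ _ _ bP) !dotZr -mulrBr; congr (_ * _).
  by apply/eqP; rewrite eq_complex /= oppr0 !eqxx.
move=> x y; apply/subr0_eq; rewrite -/(B x y).
have := BD x y; rewrite !B0 !add0r => /esym/eqP; rewrite addr_eq0 => /eqP h.
have := BD ('i *: x) y; rewrite !B0 !add0r BZ BZr mulNr -mulrBr => /esym/eqP.
rewrite mulf_eq0 => /orP[/eqP[/eqP]|]; first by rewrite oner_eq0.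
rewrite -[B y x]opprK -h opprK -mulr2n mulrn_eq0/= => /eqP//.
Qed.

(** * The absolute value of a bounded operator *)

Section AbsOp.
Variable T : H -> H.
Hypothesis bT : bop T.
Let Ts := adjoint dot setT setT T.
Let P := abs_op dot T.

Lemma adjoint_bop : bop Ts.
Proof. by have [] := adjointP hdot csub_setT csub_setT bT. Qed.

Lemma adjoint_dot x y : dot (T x) y = dot x (Ts y).
Proof. by have [_ ->] := adjointP hdot csub_setT csub_setT bT. Qed.

Lemma abs_op_spec : [/\ bop P, op_le dot setT (fun=> 0) P
  & forall x, P (P x) = Ts (T x)].
Proof.
suff /(xgetPex (fun=> 0)) : exists S, [/\ bop S, op_le dot setT (fun=> 0) S
  & forall x, S (S x) = Ts (T x)] by [].
have [C C0 hC] := bop_bound adjoint_bop.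
apply: (@sqrt_op_exists _ (C ^+ 2)).
- exact: bop_comp adjoint_bop bT.
- by move=> x y /=; rewrite -adjoint_dot [RHS](dotC dot) [LHS](dotC dot)
  -adjoint_dot [dot (T _) _](dotC dot).
- by rewrite exprn_gt0.
- move=> x /=; rewrite (dotC dot) ReJ -adjoint_dot -(sqr_nrm hdot) -exprMn.
  by rewrite ler_pXn2r// ?nnegrE ?mulr_ge0 ?nrm_ge0// ltW.
Qed.

Lemma bop_abs : bop P. Proof. by case: abs_op_spec. Qed.

Lemma abs_selfadjoint : selfadjoint P.
Proof. by case: abs_op_spec => *; apply: positive_selfadjoint. Qed.

Lemma abs_ge0 x : 0 <= complex.Re (dot (P x) x).
Proof.
case: abs_op_spec => _ /(_ x I) + _; rewrite dot0l lecE => /andP[_].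
by [].
Qed.

Lemma abs_sqr x : P (P x) = Ts (T x). Proof. by case: abs_op_spec. Qed.

Lemma nrm_abs x : nrm (P x) = nrm (T x).
Proof.
apply/eqP; rewrite -(@eqrXn2 _ 2)// ?nrm_ge0// !(sqr_nrm hdot).
by rewrite abs_selfadjoint abs_sqr -adjoint_dot.
Qed.

End AbsOp.
End SquareRoot.

(** * Positive norm attaining operators *)

Section Attaining.
Context {R : realType} {H : completeNormedModType R[i]}.
Variable dot : {dot H for Num.conj}.
Hypothesis hdot : hilbert_dot dot.
Implicit Types (x y : H) (L M X : set H) (A : set R).

Lemma Re_realcM (r : R) (a : R[i]) : complex.Re (r%:C * a) = r * complex.Re a.
Proof. by case: a => p q; simpc. Qed.

(** Norm attainment on every nonzero closed subspace, phrased through the values [nrm (S x)] alone,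
    so that it transfers from [T] to [|T|]. *)
Definition attaining (S : H -> H) := forall L, closed_subspace L ->
  (exists2 x, L x & x <> 0) ->
  exists x, [/\ L x, nrm x = 1 & forall y, L y -> nrm (S y) <= nrm (S x) * nrm
    y].

Lemma op_norm_bound (S : H -> H) L y : bop S -> closed_subspace L -> L y ->
  nrm (S y) <= op_norm L S * nrm y.
Proof.
move=> bS cL Ly.
have [->|/eqP/nrm_gt0 y0] := eqVneq y 0; first by rewrite (bop0 bS) nrm0 mulr0.
have [C C0 hC] := bop_bound bS.
rewrite -ler_pdivrMr//; apply: ub_le_sup.
  exists C => _ [z [_ z1] <-]; rewrite -/(nrm _); apply: le_trans (hC z) _.
  by move: z1; rewrite normE lecR => z1; rewrite ler_piMr ?(ltW C0).
exists ((nrm y)^-1%:C *: y).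
  split; first exact: csubZ.
  by rewrite normE lecR nrmZr ger0_norm ?invr_ge0 ?nrm_ge0// mulVf// gt_eqF.
by rewrite -/(nrm _) (bopZ _ _ bS) nrmZr ger0_norm ?invr_ge0 ?nrm_ge0// mulrC.
Qed.

Lemma absolutely_norm_attaining_attaining (S : H -> H) :
  absolutely_norm_attaining S -> attaining S.
Proof.
move=> [bS aS] L cL [x0 Lx0 x00].
have [|x [Lx x1 Sx]] := aS L cL; first by move=> e; move: Lx0; rewrite e.
exists x; split => //; first by rewrite /nrm x1.
move=> y Ly; have -> : nrm (S x) = op_norm L S by rewrite /nrm Sx.
exact: op_norm_bound.
Qed.

Lemma nrm_normalize x : x <> 0 -> nrm ((nrm x)^-1%:C *: x) = 1.
Proof.
by move=> /nrm_gt0 x0; rewrite nrmZr ger0_norm ?invr_ge0 ?nrm_ge0// mulVf//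
  gt_eqF.
Qed.

Variable P : H -> H.
Hypothesis bP : bop P.
Hypothesis sP : selfadjoint dot P.
Hypothesis pP : forall x, 0 <= complex.Re (dot (P x) x).
Hypothesis aP : attaining P.

Definition eigsp (a : R) : set H := null_space (Defs.shift P a%:C).
(** A union of eigenspaces, not a subspace; [finite_dim] of it says that the eigenvalues in [A] have
    finite total multiplicity. *)
Definition eigset A : set H := [set x | exists2 a, A a & eigsp a x].

Lemma eigspP a x : eigsp a x <-> P x = a%:C *: x.
Proof.
split=> [|h]; first exact: subr0_eq.
by rewrite /eigsp /null_space/= /preimage/= /Defs.shift h subrr.
Qed.

Lemma csub_eigsp a : closed_subspace (eigsp a).
Proof. by apply: csub_null_space; apply: bop_shift. Qed.

Lemma eigset_sub A (B : set R) : A `<=` B -> eigset A `<=` eigset B.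
Proof. by move=> AB x [a /AB Ba xa]; exists a. Qed.

Lemma eigsp_ge0 a x : eigsp a x -> x <> 0 -> 0 <= a.
Proof.
move=> /eigspP xa /nrm_gt0 x0; have := pP x;
  rewrite xa dotZl (dotxx hdot) Re_realcM/=.
by rewrite pmulr_lge0// exprn_gt0.
Qed.

Lemma nrm_eigsp a x : eigsp a x -> x <> 0 -> nrm (P x) = a * nrm x.
Proof.
by move=> xa x0; rewrite ((eigspP a x).1 xa) nrmZr ger0_norm// (eigsp_ge0 xa).
Qed.

Lemma eigsp_orth a b x y : a <> b -> eigsp a x -> eigsp b y -> dot x y = 0.
Proof.
move=> ab /eigspP xa /eigspP yb; have := sP x y; rewrite xa yb dotZl dotZrr.
move=> /eqP; rewrite -subr_eq0 -mulrBl mulf_eq0 => /orP[|/eqP//].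
by rewrite subr_eq0 => /eqP[].
Qed.

Lemma eigset_orth A (B : set R) : A `&` B `<=` set0 ->
  orthogonal_sets dot (eigset A) (eigset B).
Proof.
move=> AB x y [a Aa xa] [b Bb yb]; apply: eigsp_orth xa yb => ab.
by apply: (AB a); split => //; rewrite ab.
Qed.

(** With [m] the maximum, maximality at [P x] forces [P (P x) = m^2 x]. Then [z = P x - m x]
    satisfies [P z = - m z], and positivity of [P] gives [z = 0]. *)
Lemma max_eigenvector L x : (forall y, L y -> L (P y)) -> L x -> nrm x = 1 ->
  (forall y, L y -> nrm (P y) <= nrm (P x) * nrm y) -> eigsp (nrm (P x)) x.
Proof.
move=> PL Lx x1 hx; apply/eigspP; set m := nrm (P x).
have [m0|m0] := eqVneq m 0.
  by rewrite m0 scale0r; apply: nrm_eq0.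
have mp : 0 < m by rewrite lt_neqAle eq_sym m0 nrm_ge0.
have PP : P (P x) = (m ^+ 2)%:C *: x.
  apply/subr0_eq/nrm_eq0/eqP; rewrite -[_ == 0](@sqrf_eq0 R); apply/eqP/le_anti.
  rewrite sqr_ge0 andbT (sqr_nrmB hdot) dotZrr Re_realcM sP (dotxx hdot)/= -/m.
  rewrite nrmZr x1 mulr1 ger0_norm ?sqr_ge0//.
  have := hx _ (PL _ Lx); rewrite -/m; have := nrm_ge0 (P (P x)); nra.
apply/subr0_eq; set z := P x - _.
have Pz : P z = - m%:C *: z.
  rewrite /z (bopB _ _ bP) (bopZ _ _ bP) PP scaleNr scalerBr scalerA -rmorphM/=.
  by rewrite -expr2 opprB.
have := pP z; rewrite Pz dotZl -rmorphN (dotxx hdot) Re_realcM/=.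
rewrite mulNr oppr_ge0 pmulr_rle0// => z0; apply/nrm_eq0/eqP.
by rewrite -[_ == 0](@sqrf_eq0 R) eq_le z0 sqr_ge0.
Qed.

(** First-order condition for a maximizer on a subspace that [P] may not preserve: a nonzero defect
    [d] would give a direction [w = d *: y] in which the ratio of norms increases. *)
Lemma maximizer_stationary L x : closed_subspace L -> L x -> nrm x = 1 ->
  (forall y, L y -> nrm (P y) <= nrm (P x) * nrm y) ->
  forall y, L y -> dot x (P (P y)) = (nrm (P x) ^+ 2)%:C * dot x y.
Proof.
move=> cL Lx x1 hx y Ly; set m := nrm (P x).
apply/esym/subr0_eq; set d := _ - _; apply: contrapT => /eqP d0.
set s := complex.Re `|d|; have ds : `|d| = s%:C by rewrite RRe_real// ger0_real.
have s0 : 0 < s by rewrite -ltcR -ds normr_gt0.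
pose w := d *: y.
have Lw : L w by apply: csubZ.
have sw : m ^+ 2 * complex.Re (dot x w) - complex.Re (dot (P x) (P w)) = s ^+ 2.
  rewrite sP -Re_realcM -raddfB/= /w !(bopZ _ _ bP) !dotZr mulrCA -mulrBr -/d.
  by rewrite mulrC -sqr_normc ds -rmorphXn.
(* With [t = s^2 / q] the second-order term [m^2 t^2 |w|^2] equals [t (s^2 - t)], below the
   first-order gain [2 t s^2]. *)
pose q := m ^+ 2 * nrm w ^+ 2 + 1.
have q0 : 0 < q by rewrite ltr_wpDl// mulr_ge0 ?sqr_ge0.
pose t := s ^+ 2 / q.
have t0 : 0 < t by rewrite divr_gt0 ?exprn_gt0.
have tq : t * q = s ^+ 2 by rewrite divfK// gt_eqF.
have Lz : L (x - t%:C *: w) by apply: csubB => //; apply: csubZ.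
have := hx _ Lz; rewrite -(@ler_pXn2r _ 2)// ?nnegrE ?mulr_ge0 ?nrm_ge0//.
rewrite exprMn (bopB _ _ bP) (bopZ _ _ bP) !(sqr_nrmB hdot) !dotZrr !Re_realcM.
rewrite !nrmZr !exprMn x1 (ger0_norm (ltW t0)) -/m.
move: sw; set r1 := complex.Re (dot x w); set r2 := complex.Re _ => sw.
have pw : 0 <= t ^+ 2 * nrm (P w) ^+ 2 by rewrite mulr_ge0 ?sqr_ge0.
set p2 := nrm (P w) ^+ 2 in pw *.
have e : m ^+ 2 * (t ^+ 2 * nrm w ^+ 2) = t * (t * q - t) by rewrite /q; ring.
have e2 : t * (m ^+ 2 * r1 - r2) = t * s ^+ 2 by rewrite sw.
rewrite tq in e => h; have : t * (2 * s ^+ 2) <= t * (s ^+ 2 - t) by lra.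
rewrite ler_pM2l//; have := exprn_gt0 2 s0; lra.
Qed.

(** A maximizer on the closed span of the [g n] has zero coefficient along every [g n]: stationarity
    would otherwise make [nrm (P (g n))] the maximum, but [g n.+1] exceeds it. *)
Lemma no_increasing_orthonormal (g : nat -> H) : orthonormal_seq dot g ->
  (forall m n, m <> n -> dot (P (P (g n))) (g m) = 0) ->
  (forall n, nrm (P (g n)) < nrm (P (g n.+1))) -> False.
Proof.
move=> [g1 g0] gP ginc; pose L := closed_span (range g).
have cL : closed_subspace L by apply: csub_closed_span.
have Lg n : L (g n) by apply: sub_closed_span; exists n.
have [|x [Lx x1 hx]] := aP cL.
  exists (g 0%N) => // g00; have := g1 0%N; rewrite g00 nrm0 => /eqP.
  by rewrite eq_sym oner_eq0.
have xg n : dot x (g n) = 0.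
  have st := maximizer_stationary cL Lx x1 hx (Lg n).
  (* [P (P (g n))] may leave [L], but its component in [L] is the multiple of [g n] subtracted
     here. *)
  pose r := P (P (g n)) - (nrm (P (g n)) ^+ 2)%:C *: g n.
  have rL : dot r x = 0.
    apply: (orth_closed_span hdot) Lx => _ [k _ <-].
    rewrite dotBl dotZl; have [->|/eqP kn] := eqVneq k n.
      by rewrite sP !(dotxx hdot) g1 expr1n mulr1 subrr.
    by rewrite gP// g0 ?mulr0 ?subrr//; apply/nesym.
  have : dot x (P (P (g n))) = (nrm (P (g n)) ^+ 2)%:C * dot x (g n).
    by apply/subr0_eq; rewrite -dotZrr -dotBr; apply: dot_eq0C.
  rewrite st => /eqP; rewrite -subr_eq0 -mulrBl mulf_eq0 => /orP[|/eqP//].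
  rewrite -rmorphB/= => /eqP[/eqP]; rewrite subr_eq0 eqrXn2 ?nrm_ge0// => /eqP
    e.
  have := hx _ (Lg n.+1); rewrite g1 mulr1 e => /(lt_le_trans (ginc n)).
  by rewrite ltxx.
have xx : dot x x = 0.
  by apply: (orth_closed_span hdot) Lx => _ [k _ <-].
have := dotxx_eq0 hdot xx => x0; move: x1; rewrite x0 nrm0 => /eqP.
by rewrite eq_sym oner_eq0.
Qed.

(** The orthogonal complement of all eigenvectors is invariant under [P]; were it nonzero, a
    maximizer in it would be an eigenvector. *)
Lemma eigenvectors_total x : closed_span (eigset setT) x.
Proof.
apply: (csub_eqT hdot) x; first exact: csub_closed_span.
move=> x xE; apply: contrapT => x0.
pose L := orth_compl dot (eigset setT).
have cL : closed_subspace L by apply: csub_orth_compl.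
have [|y [Ly y1 hy]] := aP cL.
  by exists x => // z Ez; apply: xE; apply: sub_closed_span.
have PL z : L z -> L (P z).
  move=> Lz e [a _ /eigspP ea]; rewrite sP ea dotZrr Lz ?mulr0//.
  by exists a => //; apply/eigspP.
have ye := max_eigenvector PL Ly y1 hy.
have /Ly /(dotxx_eq0 hdot) y0 : eigset setT y by exists (nrm (P y)).
by move: y1; rewrite y0 nrm0 => /eqP; rewrite eq_sym oner_eq0.
Qed.

(** Orthogonalizing an eigenvector against earlier eigenvectors keeps it in its eigenspace, since
    those with other eigenvalues are already orthogonal to it. *)
Lemma eig_orthonormal A : ~ finite_dim (eigset A) ->
  exists2 g, orthonormal_seq dot g & forall n, eigset A (g n).
Proof.
move=> iA; apply: (greedy_orthonormal (X := eigset A)) => s os sA.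
have /existsNP[x /not_implyP[[a Aa xa] xs]] :
    ~ forall x, eigset A x -> list_proj dot s x = x.
  by move=> /finite_dim_list_proj.
have w0 : x - list_proj dot s x <> 0 by move=> /subr0_eq/esym.
exists ((nrm (x - list_proj dot s x))^-1%:C *: (x - list_proj dot s x)); split.
- exists a => //; have ca := csub_eigsp a.
  apply: csubZ => //; apply: csubB => //; apply: csub_sum => // v vs.
  have [b Bb vb] := sA _ vs; have [ab|/eqP ab] := eqVneq a b.
    by apply: csubZ => //; rewrite ab.
  by rewrite (eigsp_orth ab xa vb) scale0r; apply: csub0.
- exact: nrm_normalize.
- by move=> w ws; rewrite dotZl (list_proj_orth hdot)// mulr0.
Qed.

Lemma unit_neq0 x : nrm x = 1 -> x <> 0.
Proof. by move=> + x0; rewrite x0 nrm0 => /eqP; rewrite eq_sym oner_eq0. Qed.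

(* Rotating an eigenvector with eigenvalue at most [a] towards an orthogonal
   one with eigenvalue at least [b] makes [nrm (P _)] take every value in
   between, in particular the terms of a strictly increasing sequence. *)
Lemma finite_dim_gap a b : a < b ->
  finite_dim (eigset [set t | t <= a]) \/ finite_dim (eigset [set t | b <= t]).
Proof.
move=> ab; apply: contrapT => /not_orP[/eig_orthonormal[e [e1 e0] eA]].
move=> /eig_orthonormal[f [f1 f0] fB].
have /choice[mu hmu] n : exists t, t <= a /\ eigsp t (e n).
  by have [t ta te] := eA n; exists t.
have /choice[nu hnu] n : exists t, b <= t /\ eigsp t (f n).
  by have [t ta te] := fB n; exists t.
have mu0 n : 0 <= mu n by apply: eigsp_ge0 (hmu n).2 (unit_neq0 (e1 n)).
have a_ge0 : 0 <= a := le_trans (mu0 0%N) (hmu 0%N).1.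
have b_gt0 : 0 < b := le_lt_trans a_ge0 ab.
have ef m n : dot (e m) (f n) = 0.
  apply: eigsp_orth (hmu m).2 (hnu n).2 => mn.
  by have := (hmu m).1; rewrite mn => /(le_trans (hnu n).1); rewrite leNgt ab.
have fe m n : dot (f m) (e n) = 0 by apply: dot_eq0C.
(* The prescribed values of [nrm (P (g n)) ^+ 2], increasing from [a ^+ 2] at [n = 0] towards
   [b ^+ 2]. *)
pose s n : R := b ^+ 2 - (b ^+ 2 - a ^+ 2) * n.+1%:R^-1.
have ab2 : 0 < b ^+ 2 - a ^+ 2 by rewrite subr_gt0 ltr_pXn2r// ?nnegrE// ltW.
have sinc n : s n < s n.+1.
  by rewrite /s ltrD2l ltrN2 ltr_pM2l// ltf_pV2 ?posrE// ltr_nat.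
have s_le n : s n <= b ^+ 2 by rewrite /s gerBl mulr_ge0 ?(ltW ab2).
have s_ge n : a ^+ 2 <= s n.
  have : n.+1%:R^-1 <= 1 :> R by rewrite invf_le1// ler1n.
  rewrite /s; move: (n.+1%:R^-1) => i h; have := ler_wpM2l (ltW ab2) h; lra.
(* Cosine and sine of the rotation; they exist because [s n] lies between [mu n ^+ 2] and
   [nu n ^+ 2]. *)
have /choice[cd hcd] n : exists p : R * R, p.1 ^+ 2 + p.2 ^+ 2 = 1 /\
    p.1 ^+ 2 * mu n ^+ 2 + p.2 ^+ 2 * nu n ^+ 2 = s n.
  have m2 : mu n ^+ 2 <= s n.
    by apply: le_trans (s_ge n); rewrite ler_pXn2r// ?nnegrE//;
      apply: (hmu n).1.
  have n2 : s n <= nu n ^+ 2.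
    apply: le_trans (s_le n) _; have bn := (hnu n).1.
    by rewrite ler_pXn2r// ?nnegrE ?(ltW b_gt0)// (le_trans (ltW b_gt0)).
  have mn : mu n ^+ 2 < nu n ^+ 2.
    rewrite ltr_pXn2r// ?nnegrE//; last by rewrite (le_trans _ (hnu n).1)// ltW.
    exact: le_lt_trans (hmu n).1 (lt_le_trans ab (hnu n).1).
  have mn0 : 0 < nu n ^+ 2 - mu n ^+ 2 by rewrite subr_gt0.
  exists (Num.sqrt ((nu n ^+ 2 - s n) / (nu n ^+ 2 - mu n ^+ 2)),
          Num.sqrt ((s n - mu n ^+ 2) / (nu n ^+ 2 - mu n ^+ 2))) => /=.
  rewrite !sqr_sqrtr ?divr_ge0 ?subr_ge0 ?(ltW mn)//.
  by split; field; rewrite gt_eqF.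
pose g n := (cd n).1%:C *: e n + (cd n).2%:C *: f n.
have Pg n : P (g n) = ((cd n).1 * mu n)%:C *: e n + ((cd n).2 * nu n)%:C *: f n.
  rewrite /g (bopD _ _ bP) !(bopZ _ _ bP) ((eigspP _ _).1 (hmu n).2).
  by rewrite ((eigspP _ _).1 (hnu n).2) !scalerA -!rmorphM.
have combo (p q : R) n : nrm (p%:C *: e n + q%:C *: f n) ^+ 2 = p ^+ 2 + q ^+ 2.
  rewrite (pythagoras hdot); last by rewrite dotZl dotZrr ef !mulr0.
  by rewrite !nrmZr e1 f1 !mulr1 !real_normK ?num_real.
have combo0 (p q p' q' : R) m n : m <> n ->
    dot (p%:C *: e m + q%:C *: f m) (p'%:C *: e n + q'%:C *: f n) = 0.
  move=> mn; rewrite !(dotDl, dotDr) !dotZl !dotZrr ef fe e0// f0//.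
  by rewrite !mulr0 !addr0.
apply: (@no_increasing_orthonormal g).
- split=> [n|m n mn]; last exact: combo0.
  apply/eqP; rewrite -(@eqrXn2 _ 2)// ?nrm_ge0// combo expr1n.
  by rewrite (hcd n).1.
- move=> m n mn; by rewrite sP !Pg; apply: combo0; exact/nesym.
- move=> n; rewrite -(@ltr_pXn2r _ 2)// ?nnegrE ?nrm_ge0// !Pg !combo !exprMn.
  by rewrite !(hcd _).2.
Qed.

Lemma no_increasing_eigenvalues (a : nat -> R) :
  (forall n, a n < a n.+1) -> (forall n, exists2 x, eigsp (a n) x & x <> 0) ->
    False.
Proof.
move=> ainc ha.
have /choice[g hg] n : exists x, eigsp (a n) x /\ nrm x = 1.
  have [x xa x0] := ha n; exists ((nrm x)^-1%:C *: x); split.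
    by apply: csubZ => //; apply: csub_eigsp.
  exact: nrm_normalize.
have amono m n : (m < n)%N -> a m < a n.
  elim: n => // n IH; rewrite ltnS leq_eqVlt => /predU1P[->//|/IH h].
  exact: lt_trans h _.
have g0 m n : m <> n -> dot (g m) (g n) = 0.
  move=> /eqP mn; apply: eigsp_orth (hg m).1 (hg n).1.
  by move: mn; rewrite neq_ltn => /orP[/amono|/amono] + e; rewrite e ltxx.
apply: (@no_increasing_orthonormal g).
- by split => // n; case: (hg n).
- move=> m n mn; have /eigspP e := (hg n).1.
  by rewrite e (bopZ _ _ bP) e !dotZl g0 ?mulr0//; apply/nesym.
- by move=> n; rewrite !(nrm_eigsp (hg _).1 (unit_neq0 (hg _).2)) !(hg _).2
  !mulr1.
Qed.

(** * The value lambda and the multiplicities of the eigenvalues around it *)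

Hypothesis Hinf : ~ finite_dim [set: H].

Definition ess_bound : R := sup [set a | ~ finite_dim (eigset [set t | a <=
  t])].
Local Notation lam := ess_bound.

Lemma finite_dim0 X : X `<=` [set 0] -> finite_dim X.
Proof. by move=> X0; exists 0%N, (fun=> 0) => x /X0 ->; exists (fun=> 0);
  rewrite big_ord0. Qed.

Lemma infinite_eigset_ge0 : ~ finite_dim (eigset [set t | 0 <= t]).
Proof.
move=> h; apply: Hinf; apply: finite_dim_sub (finite_dim_closed_span hdot h).
move=> x _; have := eigenvectors_total x; apply: closed_span_min.
  exact: csub_closed_span.
move=> {}x [a _ xa]; apply: sub_closed_span.
have [->|/eqP x0] := eqVneq x 0.
  by exists 0; [exact: lexx|exact: csub0 (csub_eigsp _)].
by exists a => //; apply: eigsp_ge0 xa x0.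
Qed.

Lemma ess_bound_has_sup : has_sup [set a | ~ finite_dim (eigset [set t | a <=
  t])].
Proof.
split; first by exists 0; apply: infinite_eigset_ge0.
have [C C0 hC] := bop_bound bP; exists C => a; apply: contra_notT.
rewrite -ltNge => Ca; apply: finite_dim0 => x [t /= at_ xt].
apply: contrapT => x0; have := hC x; rewrite (nrm_eigsp xt x0).
by rewrite ler_pM2r ?nrm_gt0// leNgt (lt_le_trans Ca at_).
Qed.

Lemma ess_bound_ge0 : 0 <= lam.
Proof.
have [_ ub] := ess_bound_has_sup; apply: (ub_le_sup ub).
exact: infinite_eigset_ge0.
Qed.

Lemma finite_dim_above a : lam < a -> finite_dim (eigset [set t | a <= t]).
Proof.
move=> la; apply: contrapT => h; have : a <= lam.
  by have [_ ub] := ess_bound_has_sup; apply: (ub_le_sup ub).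
by rewrite leNgt la.
Qed.

Lemma finite_dim_eigsp a : lam < a -> finite_dim (eigsp a).
Proof.
by move=> /finite_dim_above; apply: finite_dim_sub => x xa; exists a => /=.
Qed.

(** Eigenvalues up to any [a < lam] have finite total multiplicity. An infinite total below [lam]
    would therefore put an eigenvalue between any such [a] and [lam], hence a strictly increasing
    sequence of eigenvalues. *)
Lemma finite_dim_below : finite_dim (eigset [set t | t < lam]).
Proof.
have fle a : a < lam -> finite_dim (eigset [set t | t <= a]).
  move=> al; pose b := (a + lam) / 2.
  have ab : a < b by rewrite /b; lra.
  have bl : b < lam by rewrite /b; lra.
  (* The other alternative fails: the supremum defining [lam] supplies some [c > b] with infinite
     multiplicity above it. *)
  have [//|fb] := finite_dim_gap ab.
  have bl0 : 0 < lam - b by rewrite subr_gt0.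
  have [c ic] := sup_adherent bl0 ess_bound_has_sup.
  rewrite -/lam opprB addrC subrK => bc; case: ic.
  apply: finite_dim_sub fb; apply: eigset_sub => t /=; exact: le_trans (ltW bc).
apply: contrapT => il.
have /choice[f hf] a : exists t, a < lam ->
    [/\ a < t, t < lam & exists2 x, eigsp t x & x <> 0].
  have [al|] := pselect (a < lam); last by exists 0.
  apply: contrapT => /forallNP h; apply: il; apply: finite_dim_sub (fle _ al).
  move=> x [t /= tl xt]; have [->|/eqP x0] := eqVneq x 0.
    by exists a; [exact: lexx|exact: csub0 (csub_eigsp _)].
  exists t => //=; rewrite leNgt; apply/negP => at_; apply: (h t) => _;
    split => //.
  by exists x.
have l1 : lam - 1 < lam by rewrite gtrBl.
pose a n := iter n.+1 f (lam - 1).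
have al n : a n < lam.
  elim: n => [|n IH] /=; last by have [] := hf _ IH.
  by have [] := hf _ l1.
apply: (@no_increasing_eigenvalues a) => [n|n].
  by have [] := hf _ (al n).
case: n => [|n]; last by have [] := hf _ (al n).
by have [] := hf _ l1.
Qed.

(** * Norm bounds on closed spans of eigenvectors through growth of iterates *)

Section IterateGrowth.
Variable D : H -> H.
Hypothesis bD : bop D.
Hypothesis sD : selfadjoint dot D.
Variable d : R.
Hypothesis d0 : 0 < d.

(** Unlike [nrm (D x) <= d * nrm x], this condition is visibly stable under linear combinations, so
    a bound on eigenvectors reaches their span. *)
Let growth x := exists C, forall k, nrm (iter k D x) <= C * d ^+ k.

(* The norms of the iterates of a self-adjoint operator form a log-convex
   sequence, so their growth rate already bounds the first step. *)
Lemma nrm_le_of_growth x : growth x -> nrm (D x) <= d * nrm x.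
Proof.
move=> [C hC]; have [->|/eqP/nrm_gt0 x0] := eqVneq x 0.
  by rewrite (bop0 bD) nrm0 mulr0.
rewrite leNgt; apply/negP => h; pose r := nrm (D x) / nrm x.
have dr : d < r by rewrite ltr_pdivlMr.
have r0 : 0 < r := lt_trans d0 dr.
pose a k := nrm (iter k D x).
have a_step k : a k.+1 ^+ 2 <= a k * a k.+2.
  rewrite /a (sqr_nrm hdot) iterS sD; apply: Re_dot_le => //.
have ak k : 0 < a k /\ r * a k <= a k.+1.
  elim: k => [|k [a0 IH]]; first by rewrite /a /= divfK// gt_eqF.
  have a1 : 0 < a k.+1 by apply: lt_le_trans IH; rewrite mulr_gt0.
  split => //; have := a_step k => s.
  rewrite -(ler_pM2l a0); apply: le_trans s.
  by rewrite mulrA expr2 ler_pM2r// mulrC.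
have a_ge k : r ^+ k * nrm x <= a k.
  elim: k => [|k IH]; first by rewrite expr0 mul1r.
  by apply: le_trans (ak k).2; rewrite exprS -mulrA ler_pM2l.
(* The iterates grow at least like [r ^+ k], so the powers of [q > 1] would be bounded; Bernoulli's
   inequality excludes this. *)
pose q := r / d; have q1 : 0 < q - 1 by rewrite subr_gt0 ltr_pdivlMr// mul1r.
have qk k : 1 + (q - 1) *+ k <= q ^+ k.
  elim: k => [|k IH]; first by rewrite mulr0n addr0 expr0.
  rewrite exprS mulrS; have : 0 <= (q - 1) *+ k by rewrite mulrn_wge0// ltW.
  move: IH; set w := _ *+ k; set z := _ ^+ k; nra.
have qC k : q ^+ k * nrm x <= C.
  rewrite /q expr_div_n mulrAC ler_pdivrMr ?exprn_gt0//.
  exact: le_trans (a_ge k) (hC k).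
have C0 : 0 < C by apply: lt_le_trans (qC 0%N); rewrite expr0 mul1r.
have e0 : 0 < (q - 1) * nrm x / C by rewrite divr_gt0// mulr_gt0.
have [N /(_ N (leqnn N))] := inv_natS_lt e0.
rewrite ltr_pdivlMr// mulrC ltr_pdivrMr// => hN.
have := qC N.+1; rewrite leNgt => /negP; apply.
apply: lt_le_trans hN _; rewrite mulrAC ler_pM2r//.
by apply: le_trans (qk N.+1); rewrite mulr_natr lerDr.
Qed.

Lemma growth_iter x k : growth x -> nrm (iter k D x) <= d ^+ k * nrm x.
Proof.
elim: k x => [|k IH] x gx; first by rewrite expr0 mul1r.
rewrite iterSr; apply: le_trans (IH _ _) _.
  have [C hC] := gx; exists (C * d) => j.
  by rewrite -iterSr -mulrA -exprS.
by rewrite exprSr -mulrA ler_pM2l ?exprn_gt0// nrm_le_of_growth.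
Qed.

(** Closedness relies on [growth_iter]: the constant [C] may be taken to be [nrm x], which is
    continuous in [x]. *)
Lemma csub_growth : closed_subspace growth.
Proof.
have Zg (a : R[i]) x : growth x -> growth (a *: x).
  move=> [C hC]; exists (complex.Re `|a| * C) => k.
  rewrite (bopZ _ _ (bop_iter k bD)) nrmZ -mulrA ler_wpM2l//.
  by rewrite -ler0c RRe_real// ger0_real.
have Dg x y : growth x -> growth y -> growth (x + y).
  move=> [C hC] [C' hC']; exists (C + C') => k.
  rewrite (bopD _ _ (bop_iter k bD)) mulrDl.
  by apply: le_trans (nrmD _ _) _; apply: lerD.
split.
- by exists 0 => k; rewrite (bop0 (bop_iter k bD)) nrm0 mul0r.
- by move=> a x y gx gy; apply: Dg => //; apply: Zg.
- apply/closed_approx => x h; exists (nrm x) => k.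
  apply/ler_addgt0Pr => e e0.
  have [B B0 hB] := bop_bound (bop_iter k bD).
  have dk : 0 < d ^+ k by rewrite exprn_gt0.
  have s0 : 0 < B + d ^+ k by rewrite addr_gt0.
  have [y gy xy] := h _ (divr_gt0 e0 s0).
  have := growth_iter k gy; have := hB (x - y).
  rewrite (bopB _ _ (bop_iter k bD)).
  have := leB_nrm (iter k D x) (iter k D y).
  have := leB_nrm y x; rewrite (nrmC y x).
  move: xy; rewrite ltr_pdivlMr//.
  set u := nrm (x - y); set v := nrm (iter k D x - _).
  move=> h1 h2 h3 h4 h5.
  have : d ^+ k * (nrm y - nrm x) <= d ^+ k * u by rewrite ler_pM2l.
  lra.
Qed.

Lemma closed_span_growth X : (forall x, X x -> forall k, nrm (iter k D x) <= d
  ^+ k * nrm x) ->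
  forall x, closed_span X x -> nrm (D x) <= d * nrm x.
Proof.
move=> hX x Xx; apply: nrm_le_of_growth; move: x Xx.
apply: closed_span_min csub_growth _ => x Xx; exists (nrm x) => k.
by rewrite mulrC hX.
Qed.

End IterateGrowth.

(** * Compactness of the shift by lambda and the essential spectrum *)

Local Notation K := (Defs.shift P lam%:C).

Lemma shift_selfadjoint a : selfadjoint dot (Defs.shift P a%:C).
Proof. by move=> x y; rewrite /Defs.shift dotBl dotBr sP dotZl dotZrr. Qed.

(** After projecting onto the two orthogonal spans, the remainder is orthogonal to every
    eigenvector, hence zero by totality. *)
Lemma eigset_split A x : exists2 m, closed_span (eigset A) m &
  closed_span (eigset (~` A)) (x - m).
Proof.
set M := closed_span (eigset A); set N := closed_span (eigset (~` A)).
have cM : closed_subspace M by apply: csub_closed_span.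
have cN : closed_subspace N by apply: csub_closed_span.
have MN : orthogonal_sets dot N M.
  by apply: (orth_closed_spans hdot); apply: eigset_orth; rewrite setICl.
exists (proj dot M x); first exact: proj_in.
have hM z : M z -> dot (x - proj dot M x) z = 0 by move=> Mz; apply: proj_orth.
have [Np hN] := projP hdot (x - proj dot M x) cN.
set p := proj dot N _ in Np hN *; have -> // : x - proj dot M x = p.
apply/subr0_eq; set z := _ - p.
apply: (dotxx_eq0 hdot); apply: (orth_closed_span hdot) (eigenvectors_total z).
move=> y [a _ ya]; have [Aa|Aa] := pselect (A a).
  rewrite dotBl hM ?MN ?subrr//; apply: sub_closed_span; by exists a.
by apply: hN; apply: sub_closed_span; exists a.
Qed.

Lemma shift_small d x : 0 < d ->
  closed_span (eigset (~` [set t | d <= `|t - lam|])) x -> nrm (K x) <= d * nrm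
    x.
Proof.
move=> d0; apply: (closed_span_growth (bop_shift _ bP)) => //.
  exact: shift_selfadjoint.
move=> {}x [t /= /negP td /eigspP xt] k.
have e j : iter j K x = ((t - lam) ^+ j)%:C *: x.
  elim: j => [|j IH]; first by rewrite expr0 scale1r.
  rewrite iterS IH (bopZ _ _ (bop_shift _ bP)) /Defs.shift xt -scalerBl scalerA.
  by rewrite -rmorphB -rmorphM exprSr.
rewrite e nrmZr normrX ler_wpM2r ?nrm_ge0// lerXn2r ?nnegrE ?(ltW d0)//.
by apply: ltW; rewrite ltNge.
Qed.

Lemma finite_dim_away d : 0 < d -> finite_dim (eigset [set t | d <= `|t -
  lam|]).
Proof.
move=> d0; have ld : lam < lam + d by rewrite ltrDl.
apply: finite_dim_sub (finite_dimU finite_dim_below (finite_dim_above ld)).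
move=> x [t /= td xt]; have [tl|tl] := ltP t lam; first by left; exists t.
right; exists t => //=; move: td; rewrite ger0_norm ?subr_ge0// lerBrDr.
by rewrite addrC.
Qed.

(** Eigenvalues at distance at least [e] from [lam] span a finite dimensional space; on the
    complementary span [K] has norm at most [e]. *)
Lemma compact_op_shift : compact_op K.
Proof.
have bK : bop K by apply: bop_shift.
apply: compact_op_approx => // e e0.
have [C cC hC] := finite_dim_ball_compact hdot 1
  (finite_dim_closed_span hdot (finite_dim_away e0)).
exists (K @` C); first exact: compact_bop.
move=> x x1; have [m Mm Nm] := eigset_split [set t | e <= `|t - lam|] x.
have mx : nrm x ^+ 2 = nrm (x - m) ^+ 2 + nrm m ^+ 2.
  rewrite -(pythagoras hdot) ?subrK//.
  by apply: (orth_closed_spans hdot) Nm Mm; apply: eigset_orth; rewrite setICl.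
have le_of_sqr (u v w : R) : 0 <= u -> 0 <= v -> v ^+ 2 = u ^+ 2 + w ^+ 2 -> u
  <= v.
  by move=> u0 v0 h; rewrite -(@ler_pXn2r _ 2)// h lerDl sqr_ge0.
have m1 : nrm m <= 1.
  by apply: le_trans x1; apply: (@le_of_sqr _ _ (nrm (x - m)));
    rewrite ?nrm_ge0// addrC.
have xm1 : nrm (x - m) <= 1.
  by apply: le_trans x1; apply: (@le_of_sqr _ _ (nrm m)); rewrite ?nrm_ge0.
exists (K m); first by exists m => //; apply: hC.
rewrite -(bopB _ _ bK); apply: le_trans (shift_small e0 Nm) _.
by rewrite ler_piMr ?(ltW e0).
Qed.

Lemma compact_op_scale (a : R[i]) (S : H -> H) :
  compact_op S -> compact_op (fun x => a *: S x).
Proof.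
move=> cS; have bS : bop S by case: cS.
have [C cC hC] := compact_op_ball cS.
apply: compact_op_approx; first exact: bop_scale.
move=> e e0; exists ((fun x => a *: x) @` C).
  by apply: compact_bop => //; apply: bop_scale; apply: bop_id.
move=> x x1; exists (a *: S x); last by rewrite subrr nrm0 ltW.
by exists (S x) => //; apply: hC.
Qed.

(** For [z] other than [lam], dividing [P - z] by [lam - z] gives the identity plus a compact
    operator. At [lam], an inverse modulo compacts would place an orthonormal sequence in a compact
    set. *)
Lemma ess_spectrumE : ess_spectrum P = [set lam%:C].
Proof.
apply/seteqP; split => z /= h.
  apply: contrapT => /eqP zl; apply: h.
  have lz : lam%:C - z != 0 by rewrite subr_eq0 eq_sym.
  have e x : (lam%:C - z)^-1 *: (Defs.shift P z x) - x = (lam%:C - z)^-1 *: K x.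
    apply: (scalerI lz); rewrite scalerBr !scalerA divff// !scale1r.
    by rewrite /Defs.shift scalerBl opprB addrA subrK.
  exists (fun x => (lam%:C - z)^-1 *: x).
    by apply: bop_scale; apply: bop_id.
  split; rewrite /calkin_eq /=.
    rewrite (_ : (fun x => _) = (fun x => (lam%:C - z)^-1 *: K x)).
      exact: compact_op_scale compact_op_shift.
    by apply/funext => x; rewrite /= e.
  rewrite (_ : (fun x => _) = (fun x => (lam%:C - z)^-1 *: K x)).
    exact: compact_op_scale compact_op_shift.
  by apply/funext => x; rewrite /= (bopZ _ _ (bop_shift _ bP)) e.
rewrite h => -[G bG [cG _]].
have [g og _] := infinite_dim_orthonormal hdot csub_setT Hinf.
have [C cC hC] := compact_op_ball compact_op_shift.
have [E cE hE] := compact_op_ball cG.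
pose neg (x : H) : H := (-1) *: x.
have bneg : bop neg by apply: bop_scale; apply: bop_id.
apply: (compact_no_orthonormal hdot
  (compact_sum (compact_bop bG cC) (compact_bop bneg cE)) og) => n.
have gn : nrm (g n) <= 1 by case: og => ->.
exists (G (K (g n))); first by exists (K (g n)) => //; apply: hC.
exists (neg (G (K (g n)) - g n)); first by exists (G (K (g n)) - g n) => //;
  apply: hE.
by rewrite /neg scaleN1r opprB addrC subrK.
Qed.

(** * The spectrum above lambda consists of eigenvalues *)

Lemma shift_bounded_below a : lam < a -> (forall x, eigsp a x -> x = 0) ->
  exists2 c : R, 0 < c & forall x, c * nrm x <= nrm (Defs.shift P a%:C x).
Proof.
move=> la ha; apply: contrapT => hc; pose S := Defs.shift P a%:C.
have bS : bop S by apply: bop_shift.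
have /choice[u hu] n : exists x, nrm x = 1 /\ nrm (S x) < n.+1%:R^-1.
  apply: contrapT => h; apply: hc; exists n.+1%:R^-1; first by rewrite invr_gt0.
  move=> x; have [->|/eqP x0] := eqVneq x 0;
    first by rewrite nrm0 mulr0 nrm_ge0.
  rewrite leNgt; apply/negP => hx; apply: h; exists ((nrm x)^-1%:C *: x).
  split; first exact: nrm_normalize.
  rewrite (bopZ _ _ bS) nrmZr ger0_norm ?invr_ge0 ?nrm_ge0// mulrC.
  by rewrite ltr_pdivrMr// nrm_gt0.
have [C cC hC] := compact_op_ball compact_op_shift.
(* As [S = K - k] with [k = a - lam] and [S (u n)] tends to [0], the vectors [k u n] approach [p]
   along a subsequence, so [S p = 0]. *)
have [|p _ hp] := compact_seq_cluster (u := fun n => K (u n)) cC.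
  by move=> n; apply: hC; rewrite (hu n).1.
pose k := a - lam; have k0 : 0 < k by rewrite subr_gt0.
have SK x : S x = K x - k%:C *: x.
  by rewrite /S /Defs.shift /k rmorphB scalerBl opprB addrA subrK.
have close e : 0 < e -> exists2 x, nrm x = 1 &
    nrm (S x) < e /\ nrm (p - k%:C *: x) < 2 * e.
  move=> e0; have [N hN] := inv_natS_lt e0; have [n Nn np] := hp _ e0 N.
  exists (u n); first by case: (hu n).
  have Sn : nrm (S (u n)) < e by apply: lt_trans (hu n).2 (hN _ Nn).
  split => //; have -> : p - k%:C *: u n = S (u n) - (K (u n) - p).
    by rewrite SK opprB [RHS]addrC subrKA.
  apply: le_lt_trans (nrmB _ _) _; lra.
have [B B0 hB] := bop_bound bS.
have Sp : S p = 0.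
  apply/nrm_eq0/le_anti; rewrite nrm_ge0 andbT; apply/ler_addgt0Pr => e e0.
  have s0 : 0 < 2 * B + k by rewrite addr_gt0// mulr_gt0.
  have [x x1 [Sx px]] := close _ (divr_gt0 e0 s0).
  move: Sx px; set f := e / _ => Sx px.
  have ef : e = f * (2 * B + k) by rewrite divfK// gt_eqF.
  have := hB (p - k%:C *: x); rewrite (bopB _ _ bS) (bopZ _ _ bS) => h.
  have := leB_nrm (S p) (k%:C *: S x); rewrite nrmZr (ger0_norm (ltW k0)).
  have : B * nrm (p - k%:C *: x) <= B * (2 * f) by rewrite ler_pM2l// ltW.
  have : k * nrm (S x) <= k * f by rewrite ler_pM2l// ltW.
  rewrite ef; lra.
have p0 : p = 0 by apply: ha; rewrite /eigsp /null_space/= /preimage/=.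
(* With [p = 0], closeness at [k / 4] would bound the norm [k] of [k x] by [k / 2]. *)
have k4 : 0 < k / 4 by rewrite divr_gt0.
have [x x1 [_]] := close _ k4; rewrite p0 sub0r nrmN nrmZr x1 mulr1 ger0_norm
  ?(ltW k0)//.
lra.
Qed.

(** The lower bound makes [S] injective with closed range; by self-adjointness the orthogonal
    complement of the range is the kernel, so the range is everything. *)
Lemma bounded_below_invertible (S : H -> H) (c : R) : bop S -> selfadjoint dot
  S ->
  0 < c -> (forall x, c * nrm x <= nrm (S x)) ->
  exists2 G, bop G & (forall x, G (S x) = x) /\ (forall x, S (G x) = x).
Proof.
move=> bS sS c0 hc.
have inj x y : S x = S y -> x = y.
  move=> e; apply/subr0_eq/nrm_eq0/le_anti; rewrite nrm_ge0 andbT.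
  have := hc (x - y); rewrite (bopB _ _ bS) e subrr nrm0.
  by rewrite pmulr_rle0.
have cM : closed_subspace (range S).
  split; first by exists 0 => //; apply: bop0.
    by move=> a _ _ [x _ <-] [y _ <-]; exists (a *: x + y) => //;
      apply: bop_lin.
  apply/closed_approx => y hy.
  have /choice[u hu] n : exists x, nrm (y - S x) < n.+1%:R^-1.
    have n0 : (0 : R) < n.+1%:R^-1 by rewrite invr_gt0.
    by have [_ [x _ <-] yx] := hy _ n0; exists x.
  have Su : seq_lim (S \o u) y.
    move=> e /inv_natS_lt[N hN]; exists N => n /hN h.
    by rewrite nrmC; apply: lt_trans (hu n) h.
  have [|x ux] := @seq_cauchy_lim _ _ u.
    move=> e e0; have ce : 0 < c * e / 2 by rewrite divr_gt0// mulr_gt0.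
    have [N hN] := Su _ ce; exists N => m n /hN /= hm /hN /= hn.
    rewrite -(ltr_pM2l c0); apply: le_lt_trans (hc _) _; rewrite (bopB _ _ bS).
    by apply: le_lt_trans (nrm_tri y _ _) _; rewrite (nrmC y); lra.
  by exists x => //; apply: seq_lim_unique (bop_seq_lim bS ux) Su.
have surj : forall y, range S y.
  apply: (csub_eqT hdot) => // x xS; apply: inj; rewrite (bop0 bS).
  apply: (dotxx_eq0 hdot); rewrite sS; apply: xS; by exists (S x).
have /choice[G hG] y : exists x, S x = y by have [x _ xy] := surj y; exists x.
exists G; last by split => // x; apply: inj.
apply: (@bopI _ _ _ c^-1) => [a x y|x].
  by apply: inj; rewrite (bop_lin _ _ _ bS) !hG.
by rewrite ler_pdivlMl//; have := hc (G x); rewrite hG.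
Qed.

Lemma spectrum_above a : lam < a ->
  spectrum P a%:C <-> exists2 x, eigsp a x & x <> 0.
Proof.
move=> la; split => [sa|[x xa x0] [G bG [GS _]]].
  apply: contrapT => h; apply: sa.
  have [x xa|c c0 hc] := shift_bounded_below la.
    by apply: contrapT => x0; apply: h; exists x.
  by have [G bG hG] := bounded_below_invertible (bop_shift _ bP)
    (@shift_selfadjoint a) c0 hc; exists G.
by apply: x0; rewrite -(GS x) xa bop0.
Qed.

(** A vector orthogonal to all eigenvectors with eigenvalue at least [lam] lies in the closed span
    of the remaining ones. *)
Lemma finite_dim_ess_below : exists2 M, closed_subspace M /\ finite_dim M &
  forall x, (forall t y, lam <= t -> eigsp t y -> dot x y = 0) -> M x.
Proof.
exists (closed_span (eigset [set t | t < lam])).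
  split; first exact: csub_closed_span.
  exact: finite_dim_closed_span finite_dim_below.
move=> x hx; have [m Mm Nm] := eigset_split [set t | t < lam] x.
have mN y : closed_span (eigset (~` [set t | t < lam])) y -> dot x y = 0.
  by apply: (orth_closed_span hdot) => z [t /= /negP]; rewrite -leNgt => tl;
    apply: hx.
suff /subr0_eq -> : x - m = 0 by [].
apply: (dotxx_eq0 hdot); rewrite dotBl mN// sub0r; apply/eqP; rewrite oppr_eq0.
apply/eqP; apply: (orth_closed_spans hdot) Mm Nm.
by apply: eigset_orth; rewrite setICr.
Qed.

(** * Enumeration of the eigenvalues above lambda *)

Lemma finite_eigenvalues a : lam < a ->
  finite_set [set t | a <= t /\ exists2 x, eigsp t x & x <> 0].
Proof.
move=> la; apply: contrapT => /infiniteP/pcard_leP[f].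
have /choice[g hg] n : exists x, eigsp (f n) x /\ nrm x = 1.
  have [_ [x xf x0]] : [set t | a <= t /\ exists2 x, eigsp t x & x <> 0] (f n).
    by apply: funS.
  exists ((nrm x)^-1%:C *: x); split; last exact: nrm_normalize.
  by apply: csubZ => //; apply: csub_eigsp.
apply: (finite_dim_no_orthonormal hdot (g := g) (finite_dim_above la)) => [|n].
  split=> [n|m n mn]; first by case: (hg n).
  apply: eigsp_orth (hg m).1 (hg n).1 => e; apply: mn.
  by apply: (@inj _ _ _ f); rewrite ?inE.
have [an _] : [set t | a <= t /\ exists2 x, eigsp t x & x <> 0] (f n) by apply:
  funS.
by exists (f n) => //; case: (hg n).
Qed.

Definition upper_eigenvalues : set R :=
  [set t | lam < t /\ exists2 x, eigsp t x & x <> 0].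

Lemma countable_upper_eigenvalues : countable upper_eigenvalues.
Proof.
rewrite (_ : upper_eigenvalues = \bigcup_n
    [set t | lam + n.+1%:R^-1 <= t /\ exists2 x, eigsp t x & x <> 0]).
  apply: bigcup_countable => // n _; apply: finite_set_countable.
  by apply: finite_eigenvalues; rewrite ltrDl invr_gt0.
apply/seteqP; split => [t [lt_ tx]|t [n _ [nt tx]]].
  have t0 : 0 < t - lam by rewrite subr_gt0.
  have [N /(_ N (leqnn N)) hN] := inv_natS_lt t0; exists N => //; split => //.
  by rewrite -lerBrDl ltW.
split => //; apply: lt_le_trans nt; by rewrite ltrDl invr_gt0.
Qed.

Lemma upper_eigenvalues_enum : exists (J : set nat) (alpha : nat -> R),
  [/\ (exists n, J = `I_n) \/ J = [set: nat], set_inj J alpha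
    & upper_eigenvalues = alpha @` J].
Proof.
have [/finite_setP[n]|inf] := pselect (finite_set upper_eigenvalues).
  move=> /card_esym/card_set_bijP[f [f1 f2 f3]]; exists `I_n, f.
  split; [by left; exists n|exact: f2|].
  by apply/seteqP; split => // x [i ni <-]; apply: f1.
have /card_esym/card_set_bijP[f [f1 f2 f3]] :=
  eq_card_nat countable_upper_eigenvalues inf.
exists setT, f; split; [by right|exact: f2|].
by apply/seteqP; split => // x [i ni <-]; apply: f1.
Qed.

End Attaining.

(** * Isometries of finite dimensional spaces are onto *)

Section FiniteDimensionalIsometry.
Context {R : realType} {H : completeNormedModType R[i]}.
Variable dot : {dot H for Num.conj}.
Hypothesis hdot : hilbert_dot dot.

(* The part of [x] orthogonal to [V E] generates under [V] an orthogonal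
   sequence of vectors of the same norm, so it vanishes when [E] is finite
   dimensional. *)
Lemma isometry_surjective (E : set H) (V : H -> H) : closed_subspace E ->
  finite_dim E -> bop V -> (forall x, E x -> E (V x)) ->
  (forall x y, E x -> E y -> dot (V x) (V y) = dot x y) ->
  forall x, E x -> exists2 y, E y & V y = x.
Proof.
move=> cE fE bV VE iV x Ex.
have [bVs hVs] := adjointP hdot csub_setT csub_setT bV.
pose p := proj dot E (adjoint dot setT setT V x).
have Ep : E p by apply: proj_in.
exists p => //; apply/esym/subr0_eq; apply: contrapT => w0.
set w := x - V p in w0; have Ew : E w by apply: csubB => //; apply: VE.
have wV y : E y -> dot w (V y) = 0.
  move=> Ey; rewrite dotBl iV// (dot_projl hdot)//.
  by rewrite [dot (adjoint _ _ _ _ _) _](dotC dot) -hVs// -(dotC dot) subrr.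
pose u := (nrm w)^-1%:C *: w.
have Eu : E u by apply: csubZ.
have u1 : nrm u = 1 by apply: nrm_normalize.
have Ei n : E (iter n V u) by elim: n => //= n IH; apply: VE.
have iter_dot m y z : E y -> E z -> dot (iter m V y) (iter m V z) = dot y z.
  move=> Ey Ez; have Emi v n : E v -> E (iter n V v).
    by move=> Ev; elim: n => //= n IH; apply: VE.
  by elim: m => //= m IH; rewrite iV ?IH//; apply: Emi.
have lt_orth m n : (m < n)%N -> dot (iter m V u) (iter n V u) = 0.
  move=> mn; have -> : n = (m + (n - m.+1).+1)%N by rewrite -addSnnS subnKC.
  by rewrite iterD iter_dot// iterS dotZl wV// mulr0.
apply: (finite_dim_no_orthonormal hdot (g := fun n => iter n V u) fE) => //.
split=> [n|m n /eqP].
  apply/eqP; rewrite -(@eqrXn2 _ 2)// ?nrm_ge0// (sqr_nrm hdot) iter_dot//.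
  by rewrite -(sqr_nrm hdot) u1.
rewrite neq_ltn => /orP[/lt_orth//|/lt_orth]; exact: dot_eq0C.
Qed.

End FiniteDimensionalIsometry.

(** * Star-paranormal operators *)

Section StarParanormal.
Context {R : realType} {H : completeNormedModType R[i]}.
Variable dot : {dot H for Num.conj}.
Hypothesis hdot : hilbert_dot dot.
Hypothesis Hinf : ~ finite_dim [set: H].
Variable T : H -> H.
Hypothesis TAN : absolutely_norm_attaining T.
Hypothesis Tpar : star_paranormal dot T.
Implicit Types (x y z w : H) (L M X : set H).

Local Notation P := (abs_op dot T).
Local Notation Ts := (adjoint dot setT setT T).

Lemma AN_bop : bop T. Proof. by case: TAN. Qed.
Let bT := AN_bop.
Let bTs : bop Ts := adjoint_bop hdot bT.
Let bP : bop P := bop_abs hdot bT.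
Let sP : selfadjoint dot P := abs_selfadjoint hdot bT.
Let pP : forall x, 0 <= complex.Re (dot (P x) x) := abs_ge0 hdot bT.
Let nP x : nrm (P x) = nrm (T x) := nrm_abs hdot bT x.
Let TsT x : P (P x) = Ts (T x) := abs_sqr hdot bT x.

Lemma attaining_abs : attaining P.
Proof.
move=> L cL /(absolutely_norm_attaining_attaining TAN cL)[x [Lx x1 hx]].
by exists x; split => // y Ly; rewrite !nP; apply: hx.
Qed.
Let aP := attaining_abs.

Lemma star_paranormal_nrm x : nrm (Ts x) ^+ 2 <= nrm (T (T x)) * nrm x.
Proof. by rewrite -lecR rmorphXn rmorphM/= -!normE; apply: Tpar. Qed.

(** On this eigenspace [|T|^2] is the scalar [a ^+ 2]; in particular [T] is there [a] times an
    isometry. *)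
Lemma dot_eigsp a x y : eigsp P a x -> dot (T x) (T y) = (a ^+ 2)%:C * dot x y.
Proof.
move=> /eigspP xa; rewrite (adjoint_dot hdot bT) -TsT -!sP xa (bopZ _ _ bP) xa.
by rewrite !dotZl mulrA -rmorphM.
Qed.

(** For [z = T x], [nrm (Ts z) = m * nrm z], so star-paranormality gives [m^2 |z|^2 <= |T (T z)| |z|
    <= m |T z| |z|]. Hence [z] attains the bound [m] on [L], and its normalization is an eigenvector
    by [max_eigenvector]. *)
Lemma top_eigsp_invariant L m : closed_subspace L -> 0 < m ->
  (forall x, L x -> L (T x)) -> (forall x, L x -> L (P x)) ->
  (forall x, L x -> nrm (T x) <= m * nrm x) -> eigsp P m `<=` L ->
  forall x, eigsp P m x -> eigsp P m (T x).
Proof.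
move=> cL m0 TL PL hm EL x xm; have cE := csub_eigsp bP m.
have [->|/eqP x0] := eqVneq x 0; first by rewrite (bop0 bT); apply: csub0.
have nx : 0 < nrm x by apply: nrm_gt0.
have nT : nrm (T x) = m * nrm x by rewrite -nP (nrm_eigsp hdot pP xm x0).
set z := T x in nT *; have Lz : L z by apply/TL/EL.
have nz : 0 < nrm z by rewrite nT mulr_gt0.
have Tz : nrm (T z) = m * nrm z.
  apply/le_anti; rewrite hm//= .
  have := star_paranormal_nrm z; rewrite -TsT.
  have /eigspP xe := xm; rewrite xe (bopZ _ _ bP) xe scalerA -rmorphM nrmZr.
  rewrite ger0_norm ?mulr_ge0 ?(ltW m0)// => h.
  have := hm _ (TL _ Lz) => h2.
  have h3 : (m * m * nrm x) ^+ 2 <= m * nrm (T z) * nrm z.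
    by apply: le_trans h _; rewrite ler_pM2r.
  have e : (m * m * nrm x) ^+ 2 = m * nrm z * (m * nrm z) by rewrite nT; ring.
  move: h3; rewrite e [m * nrm (T z) * _]mulrAC ler_pM2l//; by rewrite mulr_gt0.
pose u := (nrm z)^-1%:C *: z.
have u1 : nrm u = 1 by apply: nrm_normalize => z0; move: nz;
  rewrite z0 nrm0 ltxx.
have Lu : L u by apply: csubZ.
have Pu : nrm (P u) = m.
  rewrite /u (bopZ _ _ bP) nrmZr nP Tz ger0_norm ?invr_ge0 ?nrm_ge0//.
  by rewrite mulrCA mulVf ?mulr1// gt_eqF.
have := max_eigenvector hdot bP sP pP PL Lu u1; rewrite Pu => /(_ _) um.
have -> : z = (nrm z)%:C *: u.
  by rewrite /u scalerA -rmorphM/= divff ?scale1r// gt_eqF.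
by apply: csubZ => //; apply: um => y Ly; rewrite nP; apply: hm.
Qed.

(** * Eigenspaces above lambda reduce the operator *)

Local Notation lam := (ess_bound P).

Definition reducing a := (forall x, eigsp P a x -> eigsp P a (T x)) /\
  (forall x, eigsp P a x -> eigsp P a (Ts x)).

Lemma scaled_eigsp_surjective a : lam < a ->
  (forall x, eigsp P a x -> eigsp P a (T x)) ->
  forall x, eigsp P a x -> exists2 y, eigsp P a y & a^-1%:C *: T y = x.
Proof.
move=> la TE; have a0 : 0 < a.
  exact: le_lt_trans (ess_bound_ge0 hdot bP sP pP aP Hinf) la.
have cE := csub_eigsp bP a.
apply: (isometry_surjective hdot cE) => //.
- exact: (finite_dim_eigsp hdot bP sP pP aP Hinf la).
- exact: bop_scale.
- by move=> x xa; apply: csubZ => //; apply: TE.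
- move=> x y xa ya; rewrite dotZl dotZrr (dot_eigsp _ xa) !mulrA -!rmorphM/=.
  rewrite (_ : _ * _ * _ = 1) ?mul1r// expr2 -mulrA [a^-1 * (a * a)]mulKf
    ?gt_eqF//.
  by rewrite mulVf// gt_eqF.
Qed.

(** Every [x] in the eigenspace is [a^-1 T y] with [y] in it, by finite dimensionality, and then
    [Ts x] is a multiple of [Ts (T y) = a^2 y]. *)
Lemma reducing_of_invariant a : lam < a ->
  (forall x, eigsp P a x -> eigsp P a (T x)) -> reducing a.
Proof.
move=> la TE; split => // x xa.
have [y ya <-] := scaled_eigsp_surjective la TE xa.
have /eigspP ye := ya; rewrite (bopZ _ _ bTs) -TsT ye (bopZ _ _ bP) ye.
have cE := csub_eigsp bP a; by do 3 apply: (csubZ _ cE).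
Qed.

Section ReducingSpan.
Variable G : set R.
Hypothesis hG : forall a, G a -> reducing a.
Let W := closed_span (eigset P G).
Let L := orth_compl dot W.

Lemma reducing_span_T x : W x -> W (T x).
Proof.
apply: closed_span_stable => // y [a Ga ya]; apply: sub_closed_span.
by exists a => //; apply: (hG Ga).1.
Qed.

Lemma reducing_orth_T x : L x -> L (T x).
Proof.
move=> Lx y Wy; rewrite (adjoint_dot hdot bT); apply: Lx; move: y Wy.
apply: closed_span_stable => // y [a Ga ya]; apply: sub_closed_span.
by exists a => //; apply: (hG Ga).2.
Qed.

Lemma reducing_orth_P x : L x -> L (P x).
Proof.
move=> Lx y Wy; rewrite sP; apply: Lx; move: y Wy.
apply: closed_span_stable => // y [a Ga ya]; apply: sub_closed_span;
  exists a => //.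
by have /eigspP -> := ya; apply: csubZ => //; apply: csub_eigsp.
Qed.

Lemma eigsp_sub_orth a : ~ G a -> eigsp P a `<=` L.
Proof.
move=> nG x xa; apply: (orth_closed_span hdot) => y [b Gb yb].
by apply: (eigsp_orth sP) xa yb => ab; apply: nG; rewrite ab.
Qed.

End ReducingSpan.

Let G := [set a | lam < a /\ reducing a].
Let hG a : G a -> reducing a. Proof. by case. Qed.

(** A maximum [m > lam] on the complement would have its eigenspace inside the complement, hence
    invariant and reducing; then [m] belongs to [G], and its maximizer would be orthogonal to
    itself. *)
Lemma nrm_T_le_reducing x : orth_compl dot (closed_span (eigset P G)) x ->
  nrm (T x) <= lam * nrm x.
Proof.
set L := orth_compl _ _ => Lx; have cL : closed_subspace L by apply:
  csub_orth_compl.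
have [->|/eqP x0] := eqVneq x 0; first by rewrite (bop0 bT) !nrm0 mulr0.
have [|y [Ly y1 hy]] := aP cL; first by exists x.
have PL z : L z -> L (P z) by apply: reducing_orth_P.
have ym := max_eigenvector hdot bP sP pP PL Ly y1 hy.
set m := nrm (P y) in hy ym.
have [ml|lm] := leP m lam.
  by rewrite -nP; apply: le_trans (hy _ Lx) _; rewrite ler_wpM2r ?nrm_ge0.
have nG : ~ G m.
  move=> Gm; have yW : closed_span (eigset P G) y.
    by apply: sub_closed_span; exists m.
  by apply: (unit_neq0 y1); apply: (dotxx_eq0 hdot); apply: Ly.
have EL := eigsp_sub_orth nG.
case: nG; split => //; apply: reducing_of_invariant => //.
apply: (top_eigsp_invariant cL) => //.
- exact: le_lt_trans (ess_bound_ge0 hdot bP sP pP aP Hinf) lm.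
- exact: (reducing_orth_T hG).
- by move=> z Lz; rewrite -nP; apply: hy.
Qed.

(** A non-reducing eigenspace would lie in the complement, where [T] is bounded by [lam < a], so it
    would be zero; but the zero space reduces. *)
Lemma reducing_above a : lam < a -> reducing a.
Proof.
move=> la; apply: contrapT => nr.
have EL : eigsp P a `<=` orth_compl dot (closed_span (eigset P G)).
  by apply: eigsp_sub_orth => -[].
have E0 x : eigsp P a x -> x = 0.
  move=> xa; apply: contrapT => x0; have := nrm_T_le_reducing (EL _ xa).
  rewrite -nP (nrm_eigsp hdot pP xa x0) ler_pM2r ?nrm_gt0//.
  by rewrite leNgt la.
have c0 := csub0 (csub_eigsp bP a).
by apply: nr; split => x /E0 ->; rewrite ?(bop0 bT) ?(bop0 bTs).
Qed.

(** * The three orthogonal summands *)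

Let lam_ge0 : 0 <= lam := ess_bound_ge0 hdot bP sP pP aP Hinf.

Definition upper_space : set H := closed_span (eigset P [set t | lam < t]).
Definition middle_space : set H := eigsp P lam.
Definition lower_space : set H :=
  orth_compl dot [set x + y | x in upper_space & y in middle_space].

Local Notation H0 := upper_space.
Local Notation H1 := middle_space.
Local Notation H2 := lower_space.

Lemma csub_upper : closed_subspace H0. Proof. exact: csub_closed_span. Qed.
Lemma csub_middle : closed_subspace H1. Proof. exact: csub_eigsp. Qed.
Lemma csub_lower : closed_subspace H2. Proof. exact: csub_orth_compl. Qed.
Let cH0 := csub_upper.
Let cH1 := csub_middle.
Let cH2 := csub_lower.

Lemma lower_spaceP x : H2 x <->
  (forall y, H0 y -> dot x y = 0) /\ (forall y, H1 y -> dot x y = 0).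
Proof.
split=> [h|[h0 h1] _ [y Hy [z Hz <-]]]; last by rewrite dotDr h0// h1// addr0.
split=> y Hy; apply: h.
  by exists y => //; exists 0; [exact: csub0 cH1|rewrite addr0].
by exists 0; [exact: csub0 cH0|exists y => //; rewrite add0r].
Qed.

Lemma orth_upper_T x : orth_compl dot H0 x -> orth_compl dot H0 (T x).
Proof. by apply: reducing_orth_T => a; apply: reducing_above. Qed.

Lemma nrm_T_le x : orth_compl dot H0 x -> nrm (T x) <= lam * nrm x.
Proof.
move=> Lx; apply: nrm_T_le_reducing => y Gy; apply: Lx; move: y Gy.
apply: closed_span_min => // y [a [la _] ya]; apply: sub_closed_span.
by exists a.
Qed.

Lemma middle_sub_orth : H1 `<=` orth_compl dot H0.
Proof. by apply: eigsp_sub_orth => /=; rewrite ltxx. Qed.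

Lemma lower_sub_orth : H2 `<=` orth_compl dot H0.
Proof. by move=> x /lower_spaceP[]. Qed.

Lemma T_orth_upper_eq0 x : lam = 0 -> orth_compl dot H0 x -> T x = 0.
Proof.
move=> l0 /nrm_T_le; rewrite l0 mul0r => h.
by apply/nrm_eq0/le_anti; rewrite h nrm_ge0.
Qed.

(** On the complement of [H0], [lam] bounds [T], so for [lam > 0] its eigenspace is a top eigenspace
    there; for [lam = 0], [T] vanishes on that complement. *)
Lemma middle_T x : H1 x -> H1 (T x).
Proof.
move=> Hx; have [l0|l0] := eqVneq lam 0.
  by rewrite (T_orth_upper_eq0 l0 (middle_sub_orth Hx)); apply: csub0.
have lp : 0 < lam by rewrite lt_neqAle eq_sym l0.
apply: (top_eigsp_invariant (csub_orth_compl hdot H0) lp) => //.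
- exact: orth_upper_T.
- by move=> y; apply: reducing_orth_P.
- exact: nrm_T_le.
- exact: middle_sub_orth.
Qed.

Lemma orth_upper_middle : orthogonal_sets dot H0 H1.
Proof. by move=> x y Hx Hy; apply: dot_eq0C; apply: middle_sub_orth. Qed.

Lemma orthogonal_decomposition : orth_decomposition dot H0 H1 H2.
Proof.
split; first by split.
  split; [exact: orth_upper_middle| |] => x y Hx /lower_spaceP[h0 h1];
    apply: dot_eq0C; auto.
move=> x; pose x0 := proj dot H0 x; pose x1 := proj dot H1 x.
have Hx0 : H0 x0 by apply: proj_in.
have Hx1 : H1 x1 by apply: proj_in.
exists x0, x1, (x - x0 - x1); split => //; last first.
  by rewrite -[x - x0 - x1]addrA -opprD [RHS]addrC subrK.
apply/lower_spaceP; split=> y Hy.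
  by rewrite dotBl (proj_orth hdot)// (dot_eq0C (orth_upper_middle Hy Hx1))
    subrr.
by rewrite addrAC dotBl (proj_orth hdot)// (orth_upper_middle Hx0 Hy) subrr.
Qed.

Lemma orth_upper_split x : orth_compl dot H0 x ->
  x = proj dot H1 x + proj dot H2 x.
Proof.
move=> Lx; have -> : proj dot H2 x = x - proj dot H1 x;
  last by rewrite [RHS]addrC subrK.
have Hp := proj_in hdot x cH1.
apply: (proj_unique hdot) => // [|y /lower_spaceP[_ h1]].
  apply/lower_spaceP; split=> y Hy; last exact: proj_orth.
  by rewrite dotBl Lx// (dot_eq0C (orth_upper_middle Hy Hp)) subrr.
by rewrite opprB addrC subrK; apply: dot_eq0C; apply: h1.
Qed.

Lemma finite_dim_lower : finite_dim H2.
Proof.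
have [M [cM fM] hM] := finite_dim_ess_below hdot bP sP pP aP Hinf.
apply: finite_dim_sub fM => x /lower_spaceP[h0 h1]; apply: hM => t y.
rewrite le_eqVlt => /predU1P[<-|lt_] yt; first exact: h1.
by apply: h0; apply: sub_closed_span; exists t.
Qed.

(** * The blocks of the operator matrix and their inequalities *)

Definition middle_isometry : H -> H :=
  if lam == 0 then id else fun x => lam^-1%:C *: T x.
Definition middle_corner x : H := proj dot H1 (T x).
Definition lower_corner x : H := proj dot H2 (T x).

Local Notation V := middle_isometry.
Local Notation A := middle_corner.
Local Notation B := lower_corner.

Lemma bop_middle_corner : bop A.
Proof. exact: bop_comp (bop_proj hdot cH1) bT. Qed.

Lemma bop_lower_corner : bop B.
Proof. exact: bop_comp (bop_proj hdot cH2) bT. Qed.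

Lemma bounded_middle_corner : bounded_op H2 H1 A.
Proof. by apply: bounded_op_sub bop_middle_corner => // x _;
  apply: proj_in. Qed.

Lemma bounded_lower_corner : bounded_op H2 H2 B.
Proof. by apply: bounded_op_sub bop_lower_corner => // x _; apply: proj_in. Qed.

Lemma bop_middle_isometry : bop V.
Proof. by rewrite /middle_isometry; case: ifP => _;
  [exact: bop_id|exact: bop_scale]. Qed.

Lemma middle_isometry_in x : H1 x -> H1 (V x).
Proof. by rewrite /middle_isometry; case: ifP => // _ Hx; apply: csubZ => //;
  apply: middle_T. Qed.

Lemma bounded_middle_isometry : bounded_op H1 H1 V.
Proof. by apply: bounded_op_sub bop_middle_isometry => // x;
  apply: middle_isometry_in. Qed.

(** For [lam = 0], [T] is zero on [H1], so the identity chosen for [V] in that case is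
    compatible. *)
Lemma scale_middle_isometry x : H1 x -> lam%:C *: V x = T x.
Proof.
move=> Hx; rewrite /middle_isometry; have [l0|l0] := eqVneq lam 0.
  by rewrite l0 scale0r (T_orth_upper_eq0 l0 (middle_sub_orth Hx)).
by rewrite scalerA -rmorphM/= divff// scale1r.
Qed.

Lemma nrm_middle_isometry x : H1 x -> nrm (V x) = nrm x.
Proof.
move=> Hx; have [l0|l0] := eqVneq lam 0;
  first by rewrite /middle_isometry l0 eqxx.
have [->|/eqP x0] := eqVneq x 0; first by rewrite (bop0 bop_middle_isometry).
apply: (mulfI l0); rewrite -(nrm_eigsp hdot pP Hx x0) nP
  -(scale_middle_isometry Hx).
by rewrite nrmZr ger0_norm.
Qed.

Lemma T_matrix x0 x1 x2 : H0 x0 -> H1 x1 -> H2 x2 ->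
  T (x0 + x1 + x2) = T x0 + (lam%:C *: V x1 + A x2) + B x2.
Proof.
move=> _ Hx1 Hx2; rewrite !(bopD _ _ bT) scale_middle_isometry// -!addrA.
by rewrite [in LHS](orth_upper_split (orth_upper_T (lower_sub_orth Hx2))).
Qed.

(** For [lam > 0] and [z] in [H1], the product of [V z] with [A x] is [lam^-1] times that of [T z]
    with [T x], hence [lam] times [dot z x = 0]. This is applied to [z = V^* A x] itself. *)
Lemma adjoint_isometry_corner x : H2 x -> adjoint dot H1 H1 V (A x) = 0.
Proof.
move=> Hx; have [bV' hV'] := adjointP hdot cH1 cH1 bounded_middle_isometry.
have HA : H1 (A x) by apply: proj_in.
set z := adjoint _ _ _ _ _; have Hz : H1 z by case: bV' => + _ _; apply.
apply: (dotxx_eq0 hdot); rewrite -hV'// /middle_corner (dot_projr hdot)//;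
  last exact: middle_isometry_in.
have [l0|l0] := eqVneq lam 0.
  by rewrite (T_orth_upper_eq0 l0 (lower_sub_orth Hx)) dot0r.
rewrite /middle_isometry (negbTE l0) dotZl (dot_eigsp _ Hz).
by have /lower_spaceP[_ /(_ _ Hz)/dot_eq0C ->] := Hx; rewrite !mulr0.
Qed.

Lemma dot_adjoint_self M (N : set H) (S : H -> H) x :
  closed_subspace M -> closed_subspace N -> bounded_op M N S -> M x ->
  dot (adjoint dot M N S (S x)) x = (nrm (S x) ^+ 2)%:C.
Proof.
move=> cM cN bS Mx; have [_ hS] := adjointP hdot cM cN bS.
have NS : N (S x) by case: bS => + _ _; apply.
by rewrite (dotC dot) -hS// -(dotC dot) (dotxx hdot).
Qed.

Lemma column_bound x : H2 x -> nrm (A x) ^+ 2 + nrm (B x) ^+ 2 <= lam ^+ 2 *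
  nrm x ^+ 2.
Proof.
move=> Hx; have Lx := lower_sub_orth Hx.
rewrite -(pythagoras hdot) -?orth_upper_split.
- rewrite -exprMn ler_pXn2r// ?nnegrE ?mulr_ge0 ?nrm_ge0//; exact: nrm_T_le.
- exact: orth_upper_T.
- have /lower_spaceP[_ h1] : H2 (B x) by apply: proj_in.
  by apply: dot_eq0C; apply: h1; apply: proj_in.
Qed.

(** The adjoint of the compression [B] is dominated by [Ts], and star-paranormality gives
    [|Ts x|^2 <= |T (T x)| |x| <= lam^2 |x|^2]. *)
Lemma nrm_adjoint_lower_corner x : H2 x -> nrm (adjoint dot H2 H2 B x) ^+ 2 <=
  lam ^+ 2 * nrm x ^+ 2.
Proof.
move=> Hx; have [bB' hB'] := adjointP hdot cH2 cH2 bounded_lower_corner.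
set b := adjoint _ _ _ _ _; have Hb : H2 b by case: bB' => + _ _; apply.
have Lx := lower_sub_orth Hx.
have b2 : nrm b ^+ 2 <= nrm b * nrm (Ts x).
  rewrite (sqr_nrm hdot) -hB'// /lower_corner (dot_projl hdot)// (adjoint_dot
    hdot bT).
  exact: Re_dot_le.
have bTsx : nrm b <= nrm (Ts x).
  have [->|b0] := eqVneq (nrm b) 0; first exact: nrm_ge0.
  have bp : 0 < nrm b by rewrite lt_neqAle eq_sym b0 nrm_ge0.
  by rewrite -(ler_pM2l bp) -expr2.
apply: le_trans (_ : nrm (Ts x) ^+ 2 <= _).
  by rewrite ler_pXn2r// ?nnegrE ?nrm_ge0.
apply: le_trans (star_paranormal_nrm x) _.
rewrite [nrm x ^+ 2]expr2 mulrA ler_wpM2r ?nrm_ge0//.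
apply: le_trans (nrm_T_le (orth_upper_T Lx)) _.
by rewrite expr2 -mulrA ler_wpM2l// nrm_T_le.
Qed.

(** * The unitary parts and the eigenvalues above lambda *)

Lemma unitary_eigsp a : lam < a ->
  unitary_on dot (eigsp P a) (fun x => a^-1%:C *: T x).
Proof.
move=> la; have a0 : 0 < a by apply: le_lt_trans la.
have [TE TsE] := reducing_above la.
have cE := csub_eigsp bP a.
have bU : bounded_op (eigsp P a) (eigsp P a) (fun x => a^-1%:C *: T x).
  apply: bounded_op_sub (bop_scale a^-1%:C bT) => // x xa.
  by apply: csubZ => //; apply: TE.
have adjU : is_adjoint dot (eigsp P a) (eigsp P a) (fun x => a^-1%:C *: T x)
    (fun x => a^-1%:C *: Ts x).
  split; last by move=> x y _ _; rewrite dotZl dotZrr (adjoint_dot hdot bT).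
  apply: bounded_op_sub (bop_scale a^-1%:C bTs) => // x xa.
  by apply: csubZ => //; apply: TsE.
have UU x : eigsp P a x -> a^-1%:C *: Ts (a^-1%:C *: T x) = x.
  move=> /eigspP xa; rewrite (bopZ _ _ bTs) -TsT xa (bopZ _ _ bP) xa !scalerA.
  by rewrite -!rmorphM/= mulfVK ?mulVf ?scale1r ?gt_eqF.
have Ua x : eigsp P a x -> eigsp P a (a^-1%:C *: T x) by case: bU => + _ _;
  apply.
split => // x xa.
  by rewrite (adjointE hdot cE cE bU adjU)// ?UU//; apply: Ua.
rewrite (adjointE hdot cE cE bU adjU)//.
(* Writing [x = U y] reduces [U U^* x = x] to [U^* U y = y]. *)
have [y ya <-] := scaled_eigsp_surjective la TE xa.
by rewrite UU.
Qed.

Lemma upper_eigenvalues_spectrum :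
  [set a : R | lam < a <= op_norm setT T /\ spectrum P a%:C] =
    upper_eigenvalues P.
Proof.
apply/seteqP; split => [a [/andP[la _]]|a [la [x xa x0]]].
  by move=> /(spectrum_above hdot bP sP pP aP Hinf la).
split; last by apply/(spectrum_above hdot bP sP pP aP Hinf la); exists x.
rewrite la/= -(ler_pM2r (nrm_gt0 x0)) -(nrm_eigsp hdot pP xa x0) nP.
exact: op_norm_bound bT csub_setT _.
Qed.

Lemma upper_space_bigcup (J : set nat) (alpha : nat -> R) :
  upper_eigenvalues P = alpha @` J ->
  H0 = closed_span (\bigcup_(i in J) eigsp P (alpha i)).
Proof.
move=> e; apply/seteqP; split; apply: closed_span_min;
  try exact: csub_closed_span.
  move=> x [a la xa]; have [->|/eqP x0] := eqVneq x 0.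
    exact: csub0 (csub_closed_span _).
  have [i Ji ai] : (alpha @` J) a by rewrite -e; split => //; exists x.
  by apply: sub_closed_span; exists i => //; rewrite ai.
move=> x [i Ji xi]; apply: sub_closed_span; exists (alpha i) => //=.
have : (alpha @` J) (alpha i) by exists i.
by rewrite -e => -[].
Qed.

End StarParanormal.

(** * Assembly of the summands, the spectral data and the block inequalities *)

Theorem theorem2p12 (R : realType) (H : completeNormedModType R[i])
    (dot : {dot H for Num.conj}) (hdot : hilbert_dot dot)
    (Hinf : ~ finite_dim [set: H])
    (T : H -> H) (TAN : absolutely_norm_attaining T)
    (Tpar : star_paranormal dot T) :
  exists (lam : R) (J : set nat) (alpha : nat -> R) (H0 H1 H2 : set H)
         (V0 V A B : H -> H) (U : nat -> H -> H),
    (* the decomposition and the operator matrix *)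
    [/\ orth_decomposition dot H0 H1 H2,
        [/\ bounded_op H0 H0 V0, bounded_op H1 H1 V, bounded_op H2 H1 A
          & bounded_op H2 H2 B]
      & forall x0 x1 x2, H0 x0 -> H1 x1 -> H2 x2 ->
          T (x0 + x1 + x2) = V0 x0 + (lam%:C *: V x1 + A x2) + B x2] /\
    [/\ (* (1) *)
        0 <= lam /\ ess_spectrum (abs_op dot T) = [set lam%:C],
        (* (2) *)
        [/\ (exists n, J = `I_n) \/ J = [set: nat],
            set_inj J alpha,
            [set a : R | lam < a <= op_norm setT T /\
                         spectrum (abs_op dot T) a%:C] = alpha @` J,
            hilbert_sum dot J (fun i => abs_eigenspace dot T (alpha i)) H0
          & [/\ H1 = abs_eigenspace dot T lam,
                H2 = orth_compl dot [set x + y | x in H0 & y in H1]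
              & finite_dim H2]],
        (* (3) *)
        (forall i, J i -> unitary_on dot (abs_eigenspace dot T (alpha i)) (U i)) /\
        (forall i x, J i -> abs_eigenspace dot T (alpha i) x ->
           V0 x = (alpha i)%:C *: U i x)
      & (* (4) *)
        [/\ H1 <> [set 0] -> isometry_on H1 V,
            finite_rank H2 A /\ finite_rank H2 B,
            forall x, H2 x -> adjoint dot H1 H1 V (A x) = 0,
            op_le dot H2
              (fun x => adjoint dot H2 H1 A (A x) + adjoint dot H2 H2 B (B x))
              (fun x => (lam ^+ 2)%:C *: x)
          & forall k : R, 0 < k ->
              op_le dot H2 (fun=> 0)
                (fun x => (lam ^+ 4 + k ^+ 2)%:C *: x
                          - (2 * k)%:C *: B (adjoint dot H2 H2 B x))]].
Proof.
have bT := AN_bop TAN.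
have bP := bop_abs hdot bT; have sP := abs_selfadjoint hdot bT.
have pP := abs_ge0 hdot bT; have aP := attaining_abs hdot TAN.
pose lam := ess_bound (abs_op dot T).
have lam_ge0 : 0 <= lam := ess_bound_ge0 hdot bP sP pP aP Hinf.
have bB := bounded_lower_corner hdot TAN.
have cH1 := csub_middle hdot TAN; have cH2 := csub_lower hdot T.
have fH2 := finite_dim_lower hdot Hinf TAN.
have [J [alpha [hJ ainj ae]]] := upper_eigenvalues_enum hdot bP sP pP aP Hinf.
have la i : J i -> lam < alpha i.
  move=> Ji; have [] // : upper_eigenvalues (abs_op dot T) (alpha i).
  by rewrite ae; exists i.
(* [V0] is [T] itself, of which only the restriction to [H0] matters; each [U i] is [T] divided by
   [alpha i]. *)
exists lam, J, alpha, (upper_space dot T), (middle_space dot T),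
  (lower_space dot T), T, (middle_isometry dot T), (middle_corner dot T),
  (lower_corner dot T), (fun i x => (alpha i)^-1%:C *: T x).
split.
  split; first exact: orthogonal_decomposition.
    split=> //; [|exact: bounded_middle_isometry|exact: bounded_middle_corner].
    apply: bounded_op_sub bT => // x; apply: reducing_span_T => // a.
    exact: reducing_above.
  exact: T_matrix.
split.
- by split => //; apply: ess_spectrumE.
- split => //; first by rewrite (upper_eigenvalues_spectrum hdot Hinf TAN).
    split => [i _|i j Ji Jj ij x y xi yj|]; last exact: upper_space_bigcup.
      exact: csub_eigsp.
    by apply: (eigsp_orth sP) xi yj => /ainj; rewrite !inE => /(_ Ji Jj).
- split=> [i /la|i x /la lai xi]; first exact: unitary_eigsp.
  by rewrite scalerA -rmorphM/= divff ?scale1r// gt_eqF// (le_lt_trans lam_ge0).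
- split.
  + by move=> _ x Hx; rewrite !normE (nrm_middle_isometry hdot Hinf TAN Tpar).
  + split; apply: finite_dim_image => //.
      exact: bop_middle_corner.
    exact: bop_lower_corner.
  + exact: adjoint_isometry_corner.
  + move=> x Hx; rewrite dotDl !(dot_adjoint_self hdot)//.
      by rewrite dotZl (dotxx hdot) -rmorphD -rmorphM lecR (column_bound hdot
        Hinf TAN Tpar).
    exact: bounded_middle_corner.
  + move=> k k0 x Hx; have [bB' hB'] := adjointP hdot cH2 cH2 bB.
    set b := adjoint _ _ _ _ x.
    have Hb : lower_space dot T b by case: bB' => + _ _; apply.
    rewrite dot0l dotBl !dotZl hB'// -/b !(dotxx hdot) -!rmorphM -rmorphB ler0c.
    have := nrm_adjoint_lower_corner hdot Hinf TAN Tpar Hx; rewrite -/b -/lam.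
    set n := nrm b ^+ 2; set m := nrm x ^+ 2 => nm.
    (* Since [B B^* <= lam^2], the form is at least [(lam^4 + k^2 - 2 k lam^2) m], which is
       [(lam^2 - k)^2 m]. *)
    have h1 : k * n <= k * (lam ^+ 2 * m) by rewrite ler_pM2l.
    have h2 : 0 <= (lam ^+ 2 - k) ^+ 2 * m by rewrite mulr_ge0// sqr_ge0.
    have e : (lam ^+ 2 - k) ^+ 2 * m =
      (lam ^+ 4 + k ^+ 2) * m - 2 * (k * (lam ^+ 2 * m)) by ring.
    rewrite e in h2; lra.
Qed.
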